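(* Given a framed graph $G$, the set of Danilov-Karzanov-Koshevoy triangulations of the flow polytope $\mathcal{F}_G$ is a subset of the set of framed Postnikov-Stanley triangulations of $\mathcal{F}_G$.
   Context: Let $G$ be a connected (multi)graph on the vertex set $[n]$ with edges directed from smaller to larger vertex, such that every vertex $v\in[2,n-1]$ has both incoming and outgoing edges. The flow polytope $\mathcal{F}_G$ is the set of functions $fl:E(G)\to\mathbb{R}_{\geq 0}$ with total outflow $1$ at vertex $1$, total inflow $1$ at vertex $n$, and inflow equal to outflow at each vertex $2,\dots,n-1$. Routes are maximal directed paths from $1$ to $n$; the vertices of $\mathcal{F}_G$ are the unit flows along routes. A framing of $G$ is a choice, at each inner vertex $v$, of a linear order on the incoming edges of $v$ and a linear order on the outgoing edges of $v$; a framed graph is a graph with a framing. Danilov-Karzanov-Koshevoy triangulations: for a framed $G$ and inner vertex $v$, the maximal paths ending at $v$ are linearly ordered by: $P\prec Q$ iff, at the largest vertex $w$ after which $P,Q$ coincide and before which they differ, the edge of $P$ entering $w$ precedes the edge of $Q$ entering $w$ in the framing at $w$; maximal paths starting at $v$ are ordered analogously using outgoing edges. Two routes $P,Q$ are coherent at a common inner vertex $v$ if their initial segments ending at $v$ are ordered the same way as their final segments starting at $v$; they are coherent if coherent at every common inner vertex. A clique is a set of mutually coherent routes. For each framing, the convex hulls of the vertices of $\mathcal{F}_G$ corresponding to the routes of maximal cliques are the top-dimensional simplices of a (regular) triangulation of $\mathcal{F}_G$; these are the Danilov-Karzanov-Koshevoy triangulations. Framed Postnikov-Stanley triangulations: a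 bipartite noncrossing tree on ordered left vertices $x_1,\dots,x_\ell$ and ordered right vertices $x_{\ell+1},\dots,x_{\ell+r}$ is a tree with no pair of edges $(x_p,x_{\ell+q}),(x_t,x_{\ell+u})$ with $p<t$, $q>u$. A reduction at vertex $i$ of a framed graph takes the incoming edges $\mathcal{I}_i$ and outgoing edges $\mathcal{O}_i$ of $i$ (ordered by the framing) and, for each bipartite noncrossing tree $T$ on left set $\mathcal{I}_i$ and right set $\mathcal{O}_i$, forms the graph $G^{(i)}_T$ obtained by deleting $i$ and its incident edges and adding, for each tree edge $((r,i),(i,s))$, the edge $(r,s)$ (the ''sum'' of the two edges). $G^{(i)}_T$ gets the inheritance framing: at each vertex $j>i$ the outgoing edges keep their order; each incoming edge of $j$ in $G^{(i)}_T$ is a sum involving exactly one original incoming edge $m_l$ of $j$; letting $S(m_l)$ be those edges, edges within $S(m_l)$ are ordered top to bottom as their tree edges appear in $T$ (drawn with left and right vertices listed vertically in order), and every edge of $S(m_p)$ precedes every edge of $S(m_q)$ when $m_p$ precedes $m_q$ in the framing of $G$; edges at vertices smaller than $i$ are ordered arbitrarily. Performing reductions successively at vertices $2,3,\dots,n-1$ (each time on all resulting graphs with their inheritance framings) yields graphs on vertices $1,n$ with $\#E(G)-n+2$ edges each, whose flow polytopes are simplices that together triangulate $\mathcal{F}_G$; these are the framed Postnikov-Stanley triangulations. *)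

(* Defs.v *)
From HB Require Import structures.
From mathcomp Require Import all_boot all_order all_algebra.
From mathcomp Require Import boolp classical_sets reals.

Set Implicit Arguments.
Unset Strict Implicit.
Unset Printing Implicit Defensive.

Import Order.TTheory GRing.Theory Num.Theory.

Local Open Scope classical_set_scope.
Local Open Scope ring_scope.

(** Multigraphs whose vertex set is ['I_n]; parallel edges are distinct
    elements of [edge]. *)
Record mgraph (n : nat) := MGraph {
  edge : finType;
  src : edge -> 'I_n;
  tgt : edge -> 'I_n }.

Arguments edge {n} _.
Arguments src {n m} _.
Arguments tgt {n m} _.

(** The vertices are [0, ..., n.+1]: [ord0] is the source (vertex 1 of the
    usual numbering) and [ord_max] is the sink, so that they are distinct. *)
Definition inner (n : nat) (v : 'I_n.+2) : bool :=
  (v != ord0) && (v != ord_max).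

Definition inner_vertices (n : nat) : seq 'I_n.+2 :=
  [seq v <- enum 'I_n.+2 | inner v].

Definition increasing_edges (n : nat) (G : mgraph n) : Prop :=
  forall e : edge G, (src e < tgt e)%N.

Definition adjacent (n : nat) (G : mgraph n) : rel 'I_n := fun u v =>
  [exists e : edge G, ((src e == u) && (tgt e == v)) ||
                      ((src e == v) && (tgt e == u))].

Definition connected_graph (n : nat) (G : mgraph n) : Prop :=
  forall u v : 'I_n, connect (adjacent G) u v.

Definition inner_in_out (n : nat) (G : mgraph n.+2) : Prop :=
  forall v : 'I_n.+2, inner v ->
    (exists e : edge G, tgt e = v) /\ (exists e : edge G, src e = v).

Section FlowPolytope.
Variables (R : realType) (n : nat) (G : mgraph n.+2).

Definition outflow (fl : {ffun edge G -> R}) (v : 'I_n.+2) : R :=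
  \sum_(e : edge G | src e == v) fl e.

Definition inflow (fl : {ffun edge G -> R}) (v : 'I_n.+2) : R :=
  \sum_(e : edge G | tgt e == v) fl e.

Definition flow_polytope : set {ffun edge G -> R} :=
  [set fl : {ffun edge G -> R} | [/\ forall e, 0 <= fl e,
      outflow fl ord0 = 1,
      inflow fl ord_max = 1 &
      forall v, inner v -> inflow fl v = outflow fl v]].

End FlowPolytope.

Arguments flow_polytope R {n} G.

(** The two relations only matter on pairs of edges entering, resp. leaving,
    the same inner vertex. *)
Record framing (n : nat) (G : mgraph n) := Framing {
  in_le : rel (edge G);
  out_le : rel (edge G) }.

Definition linear_order_on (T : eqType) (A : pred T) (r : rel T) : Prop :=
  [/\ {in A, reflexive r}, {in A &, antisymmetric r},
      {in A & &, transitive r} & {in A &, total r}].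

Definition is_framing (n : nat) (G : mgraph n.+2) (F : framing G) : Prop :=
  forall v : 'I_n.+2, inner v ->
    linear_order_on [pred e | tgt e == v] (in_le F) /\
    linear_order_on [pred e | src e == v] (out_le F).

Fixpoint dpath (n : nat) (G : mgraph n) (u v : 'I_n) (p : seq (edge G)) : bool :=
  if p is e :: p' then (src e == u) && dpath (tgt e) v p' else u == v.

Section DKK.
Variables (n : nat) (G : mgraph n.+2) (F : framing G).

Definition route (p : seq (edge G)) : bool := dpath ord0 ord_max p.

(** For paths [p], [q] with a common end, [tgt e = tgt f] is the vertex after
    which [p] and [q] coincide and before which they differ. *)
Definition initial_lt (p q : seq (edge G)) : Prop :=
  exists (p' q' s : seq (edge G)) (e f : edge G),
    [/\ p = p' ++ e :: s, q = q' ++ f :: s, e != f & in_le F e f].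

Definition final_lt (p q : seq (edge G)) : Prop :=
  exists (s p' q' : seq (edge G)) (e f : edge G),
    [/\ p = s ++ e :: p', q = s ++ f :: q', e != f & out_le F e f].

Definition initial_le (p q : seq (edge G)) : Prop := p = q \/ initial_lt p q.
Definition final_le (p q : seq (edge G)) : Prop := p = q \/ final_lt p q.

(** [p1], [q1] are the initial segments of [p], [q] ending at [v], and [p2],
    [q2] the final segments starting at [v]; such segments exist exactly when
    [v] lies on the route, so the condition is void if [v] is not common. *)
Definition coherent_at (v : 'I_n.+2) (p q : seq (edge G)) : Prop :=
  forall p1 p2 q1 q2 : seq (edge G),
    p = p1 ++ p2 -> q = q1 ++ q2 ->
    dpath ord0 v p1 -> dpath v ord_max p2 ->
    dpath ord0 v q1 -> dpath v ord_max q2 ->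
    (initial_le p1 q1 /\ final_le p2 q2) \/
    (initial_le q1 p1 /\ final_le q2 p2).

Definition coherent (p q : seq (edge G)) : Prop :=
  forall v : 'I_n.+2, inner v -> coherent_at v p q.

Definition clique (C : set (seq (edge G))) : Prop :=
  (forall p, C p -> route p) /\ (forall p q, C p -> C q -> coherent p q).

Definition maximal_clique (C : set (seq (edge G))) : Prop :=
  clique C /\ forall D, clique D -> C `<=` D -> D = C.

End DKK.

Definition convex_hull (R : realType) (E : finType) (A : set {ffun E -> R}) :
    set {ffun E -> R} :=
  [set x : {ffun E -> R} |
     exists (k : nat) (t : 'I_k -> R) (a : 'I_k -> {ffun E -> R}),
     [/\ forall i, 0 <= t i, \sum_i t i = 1, forall i, A (a i) &
         forall e, x e = \sum_i t i * a i e]].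

Definition unit_flow (R : realType) (n : nat) (G : mgraph n)
    (p : seq (edge G)) : {ffun edge G -> R} :=
  [ffun e => (e \in p)%:R].

(** Triangulations are represented by their sets of top-dimensional
    simplices, each of them a subset of [R^E]. *)
Definition dkk_triangulation (R : realType) (n : nat) (G : mgraph n.+2)
    (F : framing G) : set (set {ffun edge G -> R}) :=
  [set convex_hull (@unit_flow R n.+2 G @` C) | C in maximal_clique F].

Arguments dkk_triangulation R {n G} F.

Definition is_tree (V : finType) (A : pred V) (r : rel V) : Prop :=
  [/\ exists x, A x,
      {in A &, forall x y, connect r x y} &
      forall c : seq V, (2 < size c)%N -> ~ ucycle r c].

(** [T] is the set of edges of a bipartite graph with left vertices [inl e],
    [e] an incoming edge of [i], and right vertices [inr f], [f] an outgoing
    edge of [i]. *)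
Section Reduction.
Variables (n : nat) (G : mgraph n.+2) (F : framing G) (i : 'I_n.+2).
Variable T : {set edge G * edge G}.

Definition tree_vertex : pred (edge G + edge G) := fun x =>
  match x with inl e => tgt e == i | inr f => src f == i end.

Definition tree_adj : rel (edge G + edge G) := fun x y =>
  match x, y with
  | inl e, inr f | inr f, inl e => (e, f) \in T
  | _, _ => false
  end.

Definition noncrossing_tree : Prop :=
  [/\ forall e f, (e, f) \in T -> tgt e = i /\ src f = i,
      is_tree tree_vertex tree_adj &
      forall p q t u, (p, q) \in T -> (t, u) \in T ->
        ~ [/\ p != t, in_le F p t, u != q & out_le F u q]].

(** The surviving edges of [G], and the sums [e + f] for [(e, f)] in [T]. *)
Definition reduced_edge : Type :=
  ({e : edge G | (src e != i) && (tgt e != i)} +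
   {ef : edge G * edge G | ef \in T})%type.

Definition first_part (a : reduced_edge) : edge G :=
  match a with inl e => val e | inr ef => (val ef).1 end.

Definition last_part (a : reduced_edge) : edge G :=
  match a with inl e => val e | inr ef => (val ef).2 end.

(** The deleted vertex [i] stays in the index type ['I_n.+2], without incident
    edges; its conservation law in [flow_polytope] then reads [0 = 0]. *)
Definition reduced_graph : mgraph n.+2 :=
  @MGraph n.+2 reduced_edge (fun a => src (first_part a))
    (fun a => tgt (last_part a)).

(** [S(m)] is the set of edges with [last_part] equal to [m]; for an outgoing
    edge [m] of [i], the tree edges ending at [m] are listed from top to bottom
    by their left vertices. Outgoing edges of vertices larger than [i] are
    surviving edges, so [out_le] keeps their order; the lexicographic order it
    gives at vertices smaller than [i] is one of the allowed arbitrary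
    choices. *)
Definition inheritance_framing : framing reduced_graph :=
  @Framing n.+2 reduced_graph
    (fun a b => if last_part a == last_part b
                then in_le F (first_part a) (first_part b)
                else in_le F (last_part a) (last_part b))
    (fun a b => if first_part a == first_part b
                then out_le F (last_part a) (last_part b)
                else out_le F (first_part a) (first_part b)).

(** The embedding of flows on the reduced graph into flows on [G]: an edge of
    [G] carries the flow of all the edges of the reduced graph it is part of. *)
Definition lift_flow (R : realType) (fl : {ffun edge reduced_graph -> R}) :
    {ffun edge G -> R} :=
  [ffun e => \sum_(a : edge reduced_graph |
                    (first_part a == e) || (last_part a == e)) fl a].

End Reduction.

Fixpoint ps_simplices (R : realType) (n : nat) (s : seq 'I_n.+2)
    (G : mgraph n.+2) (F : framing G) : set (set {ffun edge G -> R}) :=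
  if s is i :: s' then
    \bigcup_(T in noncrossing_tree F i)
      [set lift_flow (R := R) (T := T) @` D
         | D in @ps_simplices R n s' _ (inheritance_framing F i T)]
  else [set flow_polytope R G].

Arguments ps_simplices R {n} s {G} F.

Definition framed_ps_triangulation (R : realType) (n : nat) (G : mgraph n.+2)
    (F : framing G) : set (set {ffun edge G -> R}) :=
  ps_simplices R (inner_vertices n) F.

Arguments framed_ps_triangulation R {n G} F.

Definition dkk_triangulations (R : realType) (n : nat) (G : mgraph n.+2) :
    set (set (set {ffun edge G -> R})) :=
  [set dkk_triangulation R F | F in @is_framing n G].

Definition framed_ps_triangulations (R : realType) (n : nat)
    (G : mgraph n.+2) : set (set (set {ffun edge G -> R})) :=
  [set framed_ps_triangulation R F | F in @is_framing n G].

Arguments dkk_triangulations R {n} G.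
Arguments framed_ps_triangulations R {n} G.

(* Main.v *)
Require Import Defs.
From mathcomp Require Import all_boot all_order all_algebra.
From mathcomp Require Import boolp classical_sets reals zify.

(** The two triangulations agree for one and the same framing. Reduce the inner
    vertices in increasing order; when [i] is reduced, every edge into [i]
    starts at the source. For a maximal clique [C], let [T] be the set of
    pairs of consecutive edges at [i] used by the routes of [C]. Coherence at
    [i] makes [T] noncrossing, that is, a chain in the product of the orders on
    incoming and outgoing edges, and maximality of [C] makes it a maximal chain,
    because any path from the source extends to a route coherent with [C] at
    all later vertices. Maximal chains are exactly the noncrossing trees.
    Contracting the pairs in [T] turns [C] into a maximal clique of the reduced
    graph: the inheritance framing is such that the order on paths, hence
    coherence, is preserved. Induction on the number of inner vertices
    concludes. *)

Set Implicit Arguments.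
Unset Strict Implicit.
Unset Printing Implicit Defensive.

(** * Ranks and lexicographic comparison of lists *)

(** The delicate point is that maximality has to pass through the contraction in both directions.
    One extension result serves both: in the graph itself it shows that a pair comparable with all
    pairs of [C] is already used by [C]; in the reduced graph it shows that every tree edge is used
    by the reduced clique, so that no clique containing its expansion can pass [i] by a pair outside
    the tree. The increasing order of reductions matters because every path from the source to [i]
    is then a single edge: the order on initial segments at [i] is the framing itself, and coherence
    at [i] becomes comparability of pairs, together with coherence at the next vertex for routes
    leaving [i] along the same edge. Simplices correspond because lifting flows is linear and sends
    the unit flow of a contracted route to that of the original route; when no inner vertex is left,
    the polytope is the standard simplex on the parallel edges. *)

Section Rank.
Variables (E : finType) (A : pred E) (r : rel E).

(** Ranks turn the framing orders into comparisons of natural numbers, so that extremal edges come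
    from [arg_maxnP] and order arguments can be left to [lia]. *)
Definition rank (x : E) : nat := #|[pred y | A y && r y x]|.

Hypothesis lin : linear_order_on A r.

Lemma rank_leE x y : A x -> A y -> r x y = (rank x <= rank y).
Proof.
case: lin => refl anti trans tot Ax Ay.
apply/idP/idP => [rxy|le_xy].
  apply: subset_leq_card; apply/fintype.subsetP => z; rewrite !inE => /andP[Az rzx].
  by rewrite Az; apply: trans rzx rxy.
apply: contraTT le_xy => nrxy; rewrite -ltnNge.
have ryx : r y x by move: (tot x y Ax Ay); rewrite (negPf nrxy).
apply: proper_card; apply/fintype.properP; split.
  apply/fintype.subsetP => z; rewrite !inE => /andP[Az rzy].
  by rewrite Az; apply: trans rzy ryx.
by exists x; rewrite !inE Ax ?(negPf nrxy) //; apply: refl.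
Qed.

Lemma rank_inj x y : A x -> A y -> rank x = rank y -> x = y.
Proof.
move=> Ax Ay exy; case: (lin) => _ anti _ _.
by apply: anti => //; rewrite !rank_leE // exy leqnn.
Qed.

End Rank.

Section Lists.
Variable E : eqType.
Implicit Types (p q s t : seq E).

Lemma cat_eq_cases p1 p2 q1 q2 : p1 ++ p2 = q1 ++ q2 ->
  (exists x, q1 = p1 ++ x /\ p2 = x ++ q2) \/
  (exists x, p1 = q1 ++ x /\ q2 = x ++ p2).
Proof.
elim: p1 q1 => [|a p1 IH] [|b q1] /=.
- by move=> ->; left; exists [::].
- by move=> ->; left; exists (b :: q1).
- by move=> <-; right; exists (a :: p1).
- by case=> -> /IH [[x [-> ->]]|[x [-> ->]]]; [left|right]; exists x.
Qed.

Lemma prefix_or_diverge p q :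
  [\/ exists x, q = p ++ x, exists x, p = q ++ x |
      exists s p' q' e f, [/\ p = s ++ e :: p', q = s ++ f :: q' & e != f]].
Proof.
elim: p q => [|a p IH] [|b q].
- by constructor 1; exists [::].
- by constructor 1; exists (b :: q).
- by constructor 2; exists (a :: p).
have [<-|neq] := eqVneq a b; last first.
  by constructor 3; exists [::], p, q, a, b.
case: (IH q) => [[x ->]|[x ->]|[s [p' [q' [e [f [-> -> nef]]]]]]].
- by constructor 1; exists x.
- by constructor 2; exists x.
- by constructor 3; exists (a :: s), p', q', e, f.
Qed.

Lemma divergence_unique s t e f g h p q p' q' :
  s ++ e :: p = t ++ g :: p' -> s ++ f :: q = t ++ h :: q' ->
  e != f -> g != h -> [/\ s = t, e = g & f = h].
Proof.
elim: s t => [|a s IH] [|b t] /=.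
- by move=> [-> _] [-> _].
- by move=> [-> _] [-> _]; rewrite eqxx.
- by move=> [<- _] [<- _]; rewrite eqxx.
- by move=> [<- Ep] [Eq] nef ngh; case: (IH t Ep Eq nef ngh) => -> -> ->.
Qed.

(** A proper prefix is comparable to nothing, which is harmless on prefix-free families. Final
    segments are compared this way directly, initial segments after [rev]. *)
Definition div_lt (r : rel E) p q : Prop :=
  exists s p' q' e f, [/\ p = s ++ e :: p', q = s ++ f :: q', e != f & r e f].

Definition div_le (r : rel E) p q : Prop := p = q \/ div_lt r p q.

Lemma div_lt_cons r e f p q : e != f -> div_lt r (e :: p) (f :: q) -> r e f.
Proof.
move=> nef [[|a s] [p' [q' [e' [f' [] /=]]]]]; first by case=> -> _ [-> _].
by move=> [Ea _] [Eb _]; rewrite Ea Eb eqxx in nef.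
Qed.

Lemma div_le_cons r e f p q : e != f -> div_le r (e :: p) (f :: q) -> r e f.
Proof. by move=> nef [[Eef]|/div_lt_cons ->//]; rewrite Eef eqxx in nef. Qed.

Lemma div_le_cat r s p q : div_le r (s ++ p) (s ++ q) <-> div_le r p q.
Proof.
elim: s => //= a s IH; split=> [le_pq|/IH [->|]].
- apply/IH; case: le_pq => [[->]|[[|b t] [p' [q' [e [f [] /=]]]]]]; first by left.
    by move=> [<- _] [<- _]; rewrite eqxx.
  by move=> [_ ->] [_ ->] *; right; exists t, p', q', e, f.
- by left.
- by move=> [t [p' [q' [e [f [-> -> *]]]]]]; right; exists (a :: t), p', q', e, f.
Qed.

End Lists.

(** * Total orders on prefix-free families of lists *)

Section Branching.
Variables (E : eqType) (r : rel E) (X : seq E -> Prop).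
Hypothesis prefix_free : forall p x, X p -> X (p ++ x) -> x = [::].
(** A framing is linear only among edges meeting at one inner vertex, so linearity is asked only of
    the branches of the family at a common stem. *)
Hypothesis branch_linear : forall s e f h p q w,
  X (s ++ e :: p) -> X (s ++ f :: q) -> X (s ++ h :: w) ->
  [/\ r e f \/ r f e, r e f -> r f e -> e = f & r e f -> r f h -> r e h].

Lemma div_le_total p q : X p -> X q -> div_le r p q \/ div_le r q p.
Proof.
move=> Xp Xq.
case: (prefix_or_diverge p q) => [[x Ex]|[x Ex]|[s [p' [q' [e [f [Ep Eq nef]]]]]]].
- by move: Xq; rewrite Ex => /(prefix_free Xp) ->; rewrite cats0; do 2 left.
- by move: Xp; rewrite Ex => /(prefix_free Xq) ->; rewrite cats0; do 2 left.
rewrite Ep in Xp; rewrite Eq in Xq.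
have [[ref|rfe] _ _] := branch_linear Xp Xq Xq; [left|right]; right.
  by exists s, p', q', e, f.
by exists s, q', p', f, e; rewrite eq_sym.
Qed.

Lemma div_lt_asym p q : X p -> X q -> div_lt r p q -> ~ div_lt r q p.
Proof.
move=> Xp Xq [s [p' [q' [e [f [Ep Eq nef ref]]]]]].
move=> [t [p2 [q2 [g [h [Ep2 Eq2 ngh rgh]]]]]].
rewrite eq_sym in ngh; rewrite Ep in Eq2; rewrite Eq in Ep2.
have [_ Eh Eg] := divergence_unique Eq2 Ep2 nef ngh.
rewrite Ep in Xp; rewrite Eq in Xq; have [_ anti _] := branch_linear Xp Xq Xq.
by rewrite -Eh -Eg in rgh; rewrite (anti ref rgh) eqxx in nef.
Qed.

Lemma div_le_anti p q : X p -> X q -> div_le r p q -> div_le r q p -> p = q.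
Proof. by move=> Xp Xq [->//|lt1] [->//|/(div_lt_asym Xp Xq lt1)]. Qed.

(** The earlier of the two divergences decides; transitivity of [r] enters only when both occur
    after the same stem. *)
Lemma div_le_trans p q w : X p -> X q -> X w ->
  div_le r p q -> div_le r q w -> div_le r p w.
Proof.
move=> Xp Xq Xw [->//|lt1] [<-|lt2]; first by right.
move: lt1 lt2 => [s [p' [q' [e [f [Ep Eq nef ref]]]]]].
move=> [t [q2 [w' [g [h [Eq2 Ew ngh rgh]]]]]]; right.
rewrite Eq in Eq2; case: (cat_eq_cases Eq2) => [] [x []].
  case: x => [|a x] Et /= [Ef _].
    rewrite cats0 in Et; rewrite -{}Ef in ngh rgh.
    rewrite Ep in Xp; rewrite Eq in Xq; rewrite Ew Et in Xw.
    have [_ anti trans] := branch_linear Xp Xq Xw.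
    exists s, p', w', e, h; split=> //; rewrite ?Ew ?Et //; last exact: trans.
    apply: contra_neq ngh => Eeh; rewrite -Eeh; apply/esym/anti => //; by rewrite Eeh.
  by exists s, p', (x ++ h :: w'), e, f; rewrite Ew Et -catA /= -Ef.
case: x => [|a x] Es /= [Eg _].
  rewrite cats0 in Es; rewrite {}Eg in ngh rgh.
  rewrite Ep in Xp; rewrite Eq in Xq; rewrite Ew -Es in Xw.
  have [_ anti trans] := branch_linear Xp Xq Xw.
  exists s, p', w', e, h; split=> //; rewrite ?Ew ?Es //; last exact: trans.
  apply: contra_neq ngh => Eeh; rewrite -Eeh; apply/esym/anti => //; by rewrite Eeh.
by exists t, (x ++ e :: p'), w', g, h; rewrite Ep Es -catA /= -Eg.
Qed.

End Branching.

(** * Orders on directed paths *)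

Section Paths.
Variables (n : nat) (G : mgraph n.+2).
Hypothesis G_incr : increasing_edges G.
Implicit Types (p q x y z : seq (edge G)) (u v w : 'I_n.+2).

Definition path_end u p : 'I_n.+2 := last u [seq tgt e | e <- p].

Lemma dpath_cat u v p q :
  dpath u v (p ++ q) = dpath u (path_end u p) p && dpath (path_end u p) v q.
Proof.
by elim: p u => [|e p IH] u /=; rewrite ?eqxx // IH andbA.
Qed.

Lemma dpath_end u v p : dpath u v p -> path_end u p = v.
Proof. by elim: p u => [|e p IH] u /=; [move/eqP|case/andP=> _ /IH]. Qed.

Lemma dpath_catI u v w p q : dpath u w p -> dpath w v q -> dpath u v (p ++ q).
Proof. by move=> pP qP; rewrite dpath_cat (dpath_end pP) pP. Qed.

Lemma dpath_cat_l u v w p q : dpath u v (p ++ q) -> dpath w v q -> dpath u w p.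
Proof.
rewrite dpath_cat => /andP[]; case: q => [|e q] pP /=.
  by move=> /eqP Ev /eqP ->; rewrite -Ev.
by move=> /andP[/eqP Eu _] /andP[/eqP Ew _]; rewrite -Ew Eu.
Qed.

Lemma dpath_cat_r u v w p q : dpath u v (p ++ q) -> dpath u w p -> dpath w v q.
Proof. by rewrite dpath_cat => /andP[_ qP] /dpath_end <-. Qed.

Lemma dpath_le u v p : dpath u v p -> u <= v.
Proof.
elim: p u => [|e p IH] u /=; first by move/eqP->.
by move=> /andP[/eqP <- /IH le_tv]; apply: leq_trans le_tv; apply/ltnW/G_incr.
Qed.

Lemma dpath_cons_lt u v e p : dpath u v (e :: p) -> u < v.
Proof. by move=> /= /andP[/eqP <- /dpath_le]; apply: leq_trans; apply: G_incr. Qed.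

Lemma dpath_loop u p : dpath u u p -> p = [::].
Proof. by case: p => // e p /dpath_cons_lt; rewrite ltnn. Qed.

(** Vertices increase along a path, so the cut at the smaller vertex comes first. *)
Lemma dpath_prefix u v w p1 p2 q1 q2 : p1 ++ p2 = q1 ++ q2 ->
  dpath u v p1 -> dpath u w q1 -> v <= w ->
  exists2 x, q1 = p1 ++ x & p2 = x ++ q2.
Proof.
move=> Epq pP qP le_vw; case: (cat_eq_cases Epq) => [[x [Eq Ep]]|[x [Ep Eq]]].
  by exists x.
case: x Ep Eq => [|e x] Ep Eq; first by exists [::]; rewrite ?cats0 // Ep cats0.
by move: pP; rewrite Ep => /dpath_cat_r /(_ qP) /dpath_cons_lt; lia.
Qed.

Lemma dpath_split_unique u v p1 p2 q1 q2 : p1 ++ p2 = q1 ++ q2 ->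
  dpath u v p1 -> dpath u v q1 -> p1 = q1 /\ p2 = q2.
Proof.
move=> Epq pP qP; have [x Eq Ep] := dpath_prefix Epq pP qP (leqnn v).
have := dpath_loop (dpath_cat_r (p := p1) (q := x) (u := u) (v := v) (w := v) _ pP).
by rewrite -Eq => /(_ qP) Ex; rewrite Ep Eq Ex cats0.
Qed.

Lemma innerE v : inner v = (0 < v < n.+1).
Proof. by rewrite /inner -!val_eqE /=; have := ltn_ord v; lia. Qed.

Lemma dpath_uniq u v p : dpath u v p -> uniq p.
Proof.
suff H w q e : dpath w v q -> e \in q -> w <= src e.
  elim: p u => //= e p IH u /andP[_ pP]; rewrite (IH _ pP) andbT.
  by apply/negP => /(H _ _ _ pP); have := G_incr e; lia.
elim: q w => //= f q IH w /andP[/eqP <- qP].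
rewrite inE => /predU1P[-> //|/(IH _ qP)]; have := G_incr f; lia.
Qed.

(** * Linear orders on initial and final segments *)

Section Orders.
Variable F : framing G.
Hypothesis F_framing : is_framing F.

Lemma initial_leE p q : initial_le F p q <-> div_le (in_le F) (rev p) (rev q).
Proof.
split=> -[E|].
- by left; rewrite E.
- move=> [p' [q' [s [e [f [-> -> nef le_ef]]]]]]; right.
  by exists (rev s), (rev p'), (rev q'), e, f; rewrite !rev_cat !rev_cons !cat_rcons.
- by left; rewrite -(revK p) E revK.
- move=> [s [p' [q' [e [f [Ep Eq nef le_ef]]]]]]; right.
  exists (rev p'), (rev q'), (rev s), e, f.
  rewrite -(revK p) Ep -(revK q) Eq; split=> //.
    by rewrite rev_cat rev_cons cat_rcons.
  by rewrite rev_cat rev_cons cat_rcons.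
Qed.

Lemma final_prefix_free u p x :
  dpath u ord_max p -> dpath u ord_max (p ++ x) -> x = [::].
Proof. by move=> pP /dpath_cat_r /(_ pP) /dpath_loop. Qed.

(** The bound on [u] keeps the branching vertex off the source and the edge leaving it keeps it off
    the sink, so the framing is linear there. *)
Lemma final_branch u (u_in : 0 < u) s e f h p q x :
  dpath u ord_max (s ++ e :: p) -> dpath u ord_max (s ++ f :: q) ->
  dpath u ord_max (s ++ h :: x) ->
  [/\ out_le F e f \/ out_le F f e, out_le F e f -> out_le F f e -> e = f &
      out_le F e f -> out_le F f h -> out_le F e h].
Proof.
rewrite !dpath_cat /= => /and3P[sP e_in eP] /and3P[_ f_in _] /and3P[_ h_in _].
have [|_ [_ anti trans tot]] := F_framing (v := path_end u s).
  rewrite innerE (leq_trans u_in (dpath_le sP)) /=.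
  by move: (dpath_le eP) (G_incr e); rewrite (eqP e_in) /=; lia.
split; first by apply/orP/tot.
  by move=> ef fe; apply: anti; rewrite ?ef.
exact: trans.
Qed.

Lemma initial_prefix_free v p x :
  dpath ord0 v (rev p) -> dpath ord0 v (rev (p ++ x)) -> x = [::].
Proof.
move=> pP; rewrite rev_cat => /dpath_cat_l /(_ pP) /dpath_loop.
by move/(congr1 rev); rewrite revK.
Qed.

Lemma initial_branch v (v_in : v < n.+1) s e f h p q x :
  dpath ord0 v (rev (s ++ e :: p)) -> dpath ord0 v (rev (s ++ f :: q)) ->
  dpath ord0 v (rev (s ++ h :: x)) ->
  [/\ in_le F e f \/ in_le F f e, in_le F e f -> in_le F f e -> e = f &
      in_le F e f -> in_le F f h -> in_le F e h].
Proof.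
have H g t : dpath ord0 v (rev (s ++ g :: t)) ->
    tgt g = path_end ord0 (rev t ++ [:: g]) /\
    dpath (tgt g) v (rev s).
  rewrite rev_cat rev_cons -cats1 dpath_cat => /andP[_].
  by rewrite /path_end map_cat last_cat /=.
have K g1 t1 g2 t2 : dpath ord0 v (rev (s ++ g1 :: t1)) ->
    dpath ord0 v (rev (s ++ g2 :: t2)) -> tgt g1 = tgt g2.
  move=> g1P g2P; have [_ H2] := H _ _ g2P.
  move: g1P; rewrite rev_cat => /dpath_cat_l /(_ H2) /dpath_end.
  by rewrite rev_cons -cats1 /path_end map_cat last_cat.
move=> eP fP hP.
have [|[_ anti trans tot] _] := F_framing (v := tgt e).
  have [_ /dpath_le] := H _ _ eP; rewrite innerE.
  by have := G_incr e; lia.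
have Ef : tgt f == tgt e by rewrite (K _ _ _ _ fP eP).
have Eh : tgt h == tgt e by rewrite (K _ _ _ _ hP eP).
split; first by apply/orP/tot; rewrite ?inE.
  by move=> ef fe; apply: anti; rewrite ?inE ?ef.
by apply: trans; rewrite ?inE.
Qed.

Lemma final_le_total u p q : 0 < u ->
  dpath u ord_max p -> dpath u ord_max q -> final_le F p q \/ final_le F q p.
Proof.
move=> u_in pP qP.
exact: (div_le_total (X := dpath u ord_max) (final_prefix_free (u := u))
  (final_branch u_in)).
Qed.

Lemma final_le_anti u p q : 0 < u ->
  dpath u ord_max p -> dpath u ord_max q ->
  final_le F p q -> final_le F q p -> p = q.
Proof.
move=> u_in pP qP.
exact: (div_le_anti (X := dpath u ord_max) (final_branch u_in)).
Qed.

Lemma initial_le_total v p q : v < n.+1 ->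
  dpath ord0 v p -> dpath ord0 v q -> initial_le F p q \/ initial_le F q p.
Proof.
move=> v_in pP qP; rewrite !initial_leE.
by apply: (div_le_total (X := fun p => dpath ord0 v (rev p))
  (initial_prefix_free (v := v)) (initial_branch v_in)); rewrite revK.
Qed.

Lemma initial_le_anti v p q : v < n.+1 ->
  dpath ord0 v p -> dpath ord0 v q ->
  initial_le F p q -> initial_le F q p -> p = q.
Proof.
move=> v_in pP qP; rewrite !initial_leE => le_pq le_qp; apply: (can_inj revK).
by apply: (div_le_anti (X := fun p => dpath ord0 v (rev p))
  (initial_branch v_in) _ _ le_pq le_qp); rewrite revK.
Qed.

Lemma initial_le_trans v p q x : v < n.+1 ->
  dpath ord0 v p -> dpath ord0 v q -> dpath ord0 v x ->
  initial_le F p q -> initial_le F q x -> initial_le F p x.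
Proof.
move=> v_in pP qP wP; rewrite !initial_leE => le_pq le_qw.
by apply: (div_le_trans (X := fun p => dpath ord0 v (rev p))
  (initial_branch v_in) _ _ _ le_pq le_qw); rewrite revK.
Qed.

Lemma initial_le_cat p q s : initial_le F p q -> initial_le F (p ++ s) (q ++ s).
Proof. by rewrite !initial_leE !rev_cat => ?; apply/div_le_cat. Qed.

Lemma coherent_at_sym v p q : coherent_at F v p q -> coherent_at F v q p.
Proof.
move=> coh q1 q2 p1 p2 Eq Ep *.
by case: (coh p1 p2 q1 q2) => // ?; [right|left].
Qed.

Lemma coherent_at_refl v p : coherent_at F v p p.
Proof.
move=> p1 p2 q1 q2 -> Epq pP _ qP _.
by have [-> ->] := dpath_split_unique Epq pP qP; left; split; left.
Qed.

(** Lists form an infinite type, so the maximum is built edge by edge: the largest possible first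
    edge is chosen in the finite type of edges, and induction on [n.+2 - u] treats the tails. *)
Lemma exists_max_path u (X : seq (edge G) -> Prop) : 0 < u ->
  (forall p, X p -> dpath u ord_max p) -> (exists p, X p) ->
  exists2 p, X p & forall q, X q -> final_le F q p.
Proof.
have [m] := ubnP (n.+2 - u); elim: m u X => // m IH u X ltm u_in XP exX.
have [Eu|neu] := eqVneq u ord_max.
  have X0 p : X p -> p = [::] by move/XP; rewrite Eu; apply: dpath_loop.
  have [p Xp] := exX; exists p => // q Xq; left.
  by rewrite (X0 _ Xp) (X0 _ Xq).
have Xcons p : X p -> exists e p', p = e :: p'.
  by case: p => [/XP /= Eu|e p _]; [rewrite Eu in neu|exists e, p].
have u_inner : inner u by rewrite /inner neu andbT -val_eqE -lt0n.
have [_ lin] := F_framing u_inner.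
pose A := [pred e | `[< exists p, X (e :: p) >] ].
have Asrc e : A e -> src e == u.
  by move=> /asboolP[p /XP /=] /andP[].
have [e0 Ae0] : exists e, A e.
  by have [p Xp] := exX; have [e [p' Ep]] := Xcons p Xp; exists e;
    apply/asboolP; exists p'; rewrite -Ep.
case: (arg_maxnP (rank [pred e | src e == u] (out_le F)) Ae0) => e Ae emax.
have [||||p Xp pmax] := IH (tgt e) (fun p => X (e :: p)).
- by have := G_incr e; rewrite (eqP (Asrc _ Ae)); have := ltn_ord u; lia.
- exact: leq_ltn_trans (G_incr e).
- by move=> p /XP /= /andP[].
- by move/asboolP: Ae.
exists (e :: p) => // q Xq; have [f [q' Eq]] := Xcons q Xq.
have Af : A f by apply/asboolP; exists q'; rewrite -Eq.
rewrite Eq; have [Eef|nef] := eqVneq f e.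
  by rewrite Eef; apply/(div_le_cat _ [:: e])/pmax; rewrite -Eef -Eq.
right; exists [::], q', p, f, e; split=> //.
by rewrite (rank_leE lin) /=; [exact: emax|exact: Asrc|exact: Asrc].
Qed.

End Orders.
End Paths.

(** * Extending paths to routes coherent with a clique *)

(** Reversing all orders preserves coherence, so an extension argument for cliques passing below a
    path also covers those passing above it. *)
Definition flip_framing (n : nat) (G : mgraph n) (F : framing G) : framing G :=
  Framing (fun e f => in_le F f e) (fun e f => out_le F f e).

Section Flip.
Variables (n : nat) (G : mgraph n.+2) (F : framing G).
Implicit Types (p q x y z : seq (edge G)) (v : 'I_n.+2).

Lemma linear_order_flip (E : eqType) (A : pred E) (r : rel E) :
  linear_order_on A r -> linear_order_on A (fun a b => r b a).
Proof.
move=> [refl anti trans tot]; split=> //.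
- by move=> x y xA yA; rewrite andbC; apply: anti.
- by move=> y x z yA xA zA yx zy; apply: trans zy yx.
- by move=> x y xA yA; apply: tot.
Qed.

Lemma is_framing_flip : is_framing F -> is_framing (flip_framing F).
Proof. by move=> FP v /FP[? ?]; split; apply: linear_order_flip. Qed.

Lemma initial_le_flip p q : initial_le (flip_framing F) p q <-> initial_le F q p.
Proof.
split=> -[->|[p' [q' [s [e [f [-> -> nef le_ef]]]]]]]; try by left.
  by right; exists q', p', s, f, e; rewrite eq_sym.
by right; exists q', p', s, f, e; rewrite eq_sym.
Qed.

Lemma final_le_flip p q : final_le (flip_framing F) p q <-> final_le F q p.
Proof.
split=> -[->|[s [p' [q' [e [f [-> -> nef le_ef]]]]]]]; try by left.
  by right; exists s, q', p', f, e; rewrite eq_sym.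
by right; exists s, q', p', f, e; rewrite eq_sym.
Qed.

Lemma coherent_at_flip v p q :
  coherent_at (flip_framing F) v p q <-> coherent_at F v p q.
Proof.
split=> coh p1 p2 q1 q2 Ep Eq p1P p2P q1P q2P.
  have := coh _ _ _ _ Ep Eq p1P p2P q1P q2P.
  by rewrite !initial_le_flip !final_le_flip => -[]; [right|left].
have := coh _ _ _ _ Ep Eq p1P p2P q1P q2P.
by rewrite !initial_le_flip !final_le_flip => -[]; [right|left].
Qed.

End Flip.

Section Extension.
Variables (n : nat) (G : mgraph n.+2).
Hypothesis G_incr : increasing_edges G.
Implicit Types (p q x y z : seq (edge G)) (u v w : 'I_n.+2).

(* Either [q] runs through all of [s], or the comparison with [y ++ s] is
   decided inside [s] and does not depend on [y]. *)
Lemma initial_le_change_head F x y s q :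
  initial_le F (y ++ s) q -> (exists z, q = z ++ s) \/ initial_le F (x ++ s) q.
Proof.
case=> [<-|[p' [q' [t [e [f [Ep Eq nef le_ef]]]]]]]; first by left; exists y.
case: (cat_eq_cases Ep) => -[[|g z] [] /= Ep'].
- move=> Es; right; right; exists x, q', t, e, f; by rewrite Es.
- move=> Es; right; right; exists (x ++ g :: z), q', t, e, f.
  by rewrite Es -catA.
- move=> Es; right; right; exists x, q', t, e, f; by rewrite Es.
- by move=> [_ Et]; left; exists (q' ++ f :: z); rewrite Eq Et -catA.
Qed.

Lemma initial_ge_change_head F x y s q :
  initial_le F q (y ++ s) -> (exists z, q = z ++ s) \/ initial_le F q (x ++ s).
Proof.
by rewrite -!(initial_le_flip F); apply: initial_le_change_head.
Qed.

(* The new route follows the topmost continuation among the members of the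
   clique that reach [w] below [x]. *)
Lemma extend_from_below (F : framing G) (C : set (seq (edge G))) w x :
  is_framing F -> clique F C -> inner w -> dpath ord0 w x ->
  (exists y r, [/\ dpath ord0 w y, dpath w ord_max r, initial_le F y x & C (y ++ r)]) ->
  exists2 r, dpath w ord_max r &
    forall q v, C q -> inner v -> w <= v -> coherent_at F v (x ++ r) q.
Proof.
move=> FP [Croute Ccoh] w_in xP exL.
have /andP[w_gt0 w_lt] : 0 < w < n.+1 by rewrite -innerE.
pose X r := dpath w ord_max r /\
  exists y, [/\ dpath ord0 w y, initial_le F y x & C (y ++ r)].
have [||r [rP [y [yP le_yx Cyr]]] rmax] :=
  exists_max_path G_incr FP (u := w) (X := X) w_gt0.
- by move=> r [].
- by have [y [r [yP rP le_yx Cyr]]] := exL; exists r; split=> //; exists y.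
exists r => // q v Cq v_in le_wv p1 p2 q1 q2 Ep Eq p1P p2P q1P q2P.
have [r1 Ep1 Er] := dpath_prefix G_incr Ep xP p1P le_wv.
have r1P : dpath w v r1 by move: p1P; rewrite Ep1 => /dpath_cat_r /(_ xP).
have Eyr : y ++ r = (y ++ r1) ++ p2 by rewrite Er catA.
have coh := Ccoh _ _ Cyr Cq v v_in _ _ _ _ Eyr Eq (dpath_catI yP r1P) p2P q1P q2P.
(* If [q] does not follow all of [r1], its comparison with [y ++ r1] is decided after [w], and [y]
   may be replaced by [x]. *)
rewrite Ep1; have [[z Ez]|nz] := pselect (exists z, q1 = z ++ r1); last first.
  case: coh => -[le1 le2].
    by case: (initial_le_change_head x le1) => // ?; left.
  by case: (initial_ge_change_head x le1) => // ?; right.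
have zP : dpath ord0 w z by move: q1P; rewrite Ez => /dpath_cat_l /(_ r1P).
have r1q2P : dpath w ord_max (r1 ++ q2) := dpath_catI r1P q2P.
have Ezq : q = z ++ (r1 ++ q2) by rewrite Eq Ez catA.
(* A member of [C] that arrives at [w] below [x] belongs to the competition won by [r]. *)
have lower : initial_le F z x ->
    initial_le F q1 (x ++ r1) /\ final_le F q2 p2.
  move=> le_zx; split; first by rewrite Ez; apply: initial_le_cat.
  apply/(div_le_cat _ r1); rewrite -Er; apply: rmax; split=> //.
  by exists z; rewrite -Ezq.
case: (initial_le_total G_incr FP w_lt zP xP) => [/lower|le_xz]; first by right.
(* Now [z] lies above [x], hence above [y], and coherence at [w] of two members of [C] orders their
   continuations; the opposite outcome forces [y = z]. *)
have le_yz := initial_le_trans G_incr FP w_lt yP xP zP le_yx le_xz.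
have := Ccoh _ _ Cyr Cq w w_in _ _ _ _ erefl Ezq yP rP zP r1q2P.
case=> -[le1 le2].
  left; split; first by rewrite Ez; apply: initial_le_cat.
  by apply/(div_le_cat _ r1); rewrite -Er.
have Eyz := initial_le_anti G_incr FP w_lt yP zP le_yz le1.
by right; apply: lower; rewrite -Eyz.
Qed.

(** If a member of [C] passes through [w], it arrives below or above [x], and [extend_from_below]
    applies for [F] or for its flip. Otherwise coherence at [w] is void and the path advances by any
    edge. Outgoing edges are assumed only at targets of edges because a deleted vertex stays in the
    index type of the reduced graph, without edges. *)
Lemma extend_to_coherent_route (F : framing G) (C : set (seq (edge G))) w x :
  is_framing F ->
  (forall e : edge G, inner (tgt e) -> exists f : edge G, src f = tgt e) ->
  clique F C -> x != [::] -> dpath ord0 w x ->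
  exists2 r, dpath w ord_max r &
    forall q v, C q -> inner v -> w <= v -> coherent_at F v (x ++ r) q.
Proof.
move=> FP Gext CF; have [Croute Ccoh] := CF.
have [m] := ubnP (n.+2 - w); elim: m w x => // m IH w x ltm x0 xP.
have [Ew|new] := eqVneq w ord_max.
  exists [::]; first by rewrite Ew /=.
  by move=> q v _; rewrite innerE Ew /=; lia.
case: x x0 xP => // e x _ xP.
have w_in : inner w.
  rewrite /inner new andbT -val_eqE -lt0n.
  exact: leq_ltn_trans (dpath_cons_lt G_incr xP).
have w_lt : w < n.+1 by move: w_in; rewrite innerE => /andP[].
have [[q [y [r [Cq Eq yP rP]]]]|nthru] := pselect (exists q y r,
    [/\ C q, q = y ++ r, dpath ord0 w y & dpath w ord_max r]).
  case: (initial_le_total G_incr FP w_lt yP xP) => le_yx.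
    by apply: extend_from_below => //; exists y, r; rewrite -Eq.
  have [|||||s sP sC] := @extend_from_below (flip_framing F) C w (e :: x).
  - exact: is_framing_flip.
  - by split=> // p p' Cp Cp' v v_in; apply/coherent_at_flip/Ccoh.
  - by [].
  - by [].
  - by exists y, r; rewrite -Eq; split=> //; apply/initial_le_flip.
  by exists s => // p v Cp v_in le_wv; apply/coherent_at_flip/sC.
have [g gP] : exists g : edge G, src g = w.
  elim/last_ind: x xP {ltm} => [|x g _].
    by rewrite /= => /andP[_ /eqP Ee]; rewrite -Ee; apply: Gext; rewrite Ee.
  rewrite -rcons_cons -cats1 => /dpath_end.
  by rewrite /path_end map_cat last_cat /= => Eg; rewrite -Eg; apply: Gext; rewrite Eg.
have xgP : dpath ord0 (tgt g) ((e :: x) ++ [:: g]).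
  by apply: (dpath_catI xP); rewrite /= gP !eqxx.
have lt_wg : w < tgt g by rewrite -gP; apply: G_incr.
have [||r rP rC] := IH (tgt g) _ _ _ xgP; [|by []|].
  by have := ltn_ord (tgt g); lia.
exists (g :: r); first by rewrite /= gP eqxx.
move=> q v Cq v_in; rewrite leq_eqVlt => /predU1P[/val_inj <-|lt_wv].
  move=> p1 p2 q1 q2 _ Eq _ _ q1P q2P.
  by case: nthru; exists q, q1, q2.
move=> p1 p2 q1 q2 Ep Eq p1P p2P q1P q2P.
have [z Ez Egr] := dpath_prefix G_incr Ep xP p1P (ltnW lt_wv).
apply: (rC q v Cq v_in); rewrite -?catA //.
case: z Ez Egr => [|g' z] Ez.
  move: p1P; rewrite Ez cats0 => /dpath_end; rewrite (dpath_end xP) => Ewv.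
  by rewrite Ewv ltnn in lt_wv.
move=> [Eg _]; move: p1P; rewrite Ez => /dpath_cat_r /(_ xP) /=.
by rewrite -Eg => /andP[_] /(dpath_le G_incr).
Qed.

End Extension.

(** * Noncrossing trees as maximal chains *)

Section NoncrossingTrees.
Variables (n : nat) (G : mgraph n.+2) (F : framing G) (i : 'I_n.+2).
Hypothesis F_framing : is_framing F.
Hypothesis i_inner : inner i.
Implicit Types (T : {set edge G * edge G}) (e f : edge G).

Local Notation inrank := (rank [pred e | tgt e == i] (in_le F)).
Local Notation outrank := (rank [pred e | src e == i] (out_le F)).

(** This is comparability in the product order: equal ranks on the left impose nothing. *)
Definition compatible e f e' f' : bool :=
  ((inrank e < inrank e') ==> (outrank f <= outrank f')) &&
  ((inrank e' < inrank e) ==> (outrank f' <= outrank f)).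

Definition at_vertex T : Prop :=
  forall e f, (e, f) \in T -> tgt e = i /\ src f = i.

Definition noncrossing T : Prop :=
  forall e f e' f', (e, f) \in T -> (e', f') \in T -> compatible e f e' f'.

Definition maximal_noncrossing T : Prop :=
  forall e f, tgt e = i -> src f = i ->
  (forall e' f', (e', f') \in T -> compatible e f e' f') -> (e, f) \in T.

Lemma in_le_rank e f : tgt e = i -> tgt f = i ->
  in_le F e f = (inrank e <= inrank f).
Proof.
have [lin _] := F_framing i_inner.
by move=> Ee Ef; rewrite (rank_leE lin) //= ?Ee ?Ef.
Qed.

Lemma out_le_rank e f : src e = i -> src f = i ->
  out_le F e f = (outrank e <= outrank f).
Proof.
have [_ lin] := F_framing i_inner.
by move=> Ee Ef; rewrite (rank_leE lin) //= ?Ee ?Ef.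
Qed.

Lemma inrank_inj e f : tgt e = i -> tgt f = i -> inrank e = inrank f -> e = f.
Proof.
have [lin _] := F_framing i_inner.
by move=> Ee Ef; apply: (rank_inj lin); rewrite /= ?Ee ?Ef.
Qed.

Lemma outrank_inj e f : src e = i -> src f = i -> outrank e = outrank f -> e = f.
Proof.
have [_ lin] := F_framing i_inner.
by move=> Ee Ef; apply: (rank_inj lin); rewrite /= ?Ee ?Ef.
Qed.

Lemma inrank_neq e f : tgt e = i -> tgt f = i -> (e != f) = (inrank e != inrank f).
Proof.
move=> Ee Ef; congr (~~ _); apply/eqP/eqP => [->//|]; exact: inrank_inj.
Qed.

Lemma outrank_neq e f : src e = i -> src f = i -> (e != f) = (outrank e != outrank f).
Proof.
move=> Ee Ef; congr (~~ _); apply/eqP/eqP => [->//|]; exact: outrank_inj.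
Qed.

Lemma noncrossingE T : at_vertex T ->
  noncrossing T <->
  (forall p q t u, (p, q) \in T -> (t, u) \in T ->
     ~ [/\ p != t, in_le F p t, u != q & out_le F u q]).
Proof.
move=> Ti; split=> nc p q t u pqT tuT; have [Ep Eq] := Ti _ _ pqT;
  have [Et Eu] := Ti _ _ tuT.
  rewrite inrank_neq // in_le_rank // outrank_neq // out_le_rank //.
  move=> [n1 l1 n2 l2]; have /andP[/implyP H _] := nc _ _ _ _ pqT tuT.
  by have := H; lia.
have := nc _ _ _ _ pqT tuT; have := nc _ _ _ _ tuT pqT.
rewrite (inrank_neq Ep) // (inrank_neq Et) // !in_le_rank //.
rewrite (outrank_neq Eq) // (outrank_neq Eu) // !out_le_rank //.
move=> H1 H2; apply/andP; split; apply/implyP => lt1; rewrite leqNgt;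
  apply/negP => lt2.
  by apply: H2; split; lia.
by apply: H1; split; lia.
Qed.

(* At the topmost left vertex of a cycle, the two cycle edges and the two
   cycle edges that follow them cannot be noncrossing. *)
Lemma noncrossing_acyclic T : at_vertex T -> noncrossing T ->
  forall c, 2 < size c -> ~ ucycle (tree_adj T) c.
Proof.
move=> Ti nc c sz_c cyc.
pose A := [pred e | inl e \in c].
have [e0 Ae0] : exists e, A e.
  case: c sz_c cyc @A => [|[e|f] [|[e'|f'] c]] //= _.
  - by move=> _; exists e; rewrite !inE eqxx.
  - by move=> _; exists e'; rewrite !inE eqxx orbT.
case: (arg_maxnP inrank Ae0) => e Ae max_e.
have emax j : A j -> inrank j <= inrank e by apply: max_e.
have /rot_to[k s Es] : inl e \in c by [].
have: ucycle (tree_adj T) (inl e :: s) by rewrite -Es /ucycle rot_cycle rot_uniq.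
have sz_s : 1 < size s by rewrite -ltnS -[X in _ < X]/(size (inl e :: s)) -Es size_rot.
have sub x : x \in s -> x \in c by move=> xs; rewrite -(mem_rot k) Es inE xs orbT.
case/andP; case: s sz_s sub {Es} => [|[?|f1] [|[e1|?] s]] //=; last by rewrite andbF.
elim/last_ind: s => [|s [?|f2] _] _ sub /=; rewrite ?andbF //.
  by rewrite rcons_path last_rcons /= !andbF.
rewrite !rcons_path last_rcons => /and3P[ef1 e1f1 /andP[]].
(* From the left vertex [e] of largest rank, the cycle reads [e], [f1], [e1], ..., [e2], [f2], where
   [e1] and [e2] coincide if its length is four. *)
case E2: (last _ s) => [e2|g] /andP[sP e2f2] ef2; last by [].

rewrite !inE !mem_rcons !inE /= => /and4P[].
have e2s : (inl e2 : edge G + edge G) \in inl e1 :: s by rewrite -E2 mem_last.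
move=> ne1 nf _ _.
have ne2 : inrank e2 < inrank e.
  have [Ee _] := Ti _ _ ef2; have [Ee2 _] := Ti _ _ e2f2.
  rewrite ltn_neqAle -inrank_neq // emax ?andbT; last first.
    apply: sub; rewrite inE -[_ :: rcons _ _]/(rcons (_ :: _) _) mem_rcons.
    by rewrite inE e2s !orbT.
  apply: contraNneq ne1 => Ee2e; move: e2s; rewrite Ee2e inE.
  by case/predU1P => [->|->]; rewrite ?eqxx ?orbT.
have ne1' : inrank e1 < inrank e.
  have [Ee _] := Ti _ _ ef2; have [Ee1 _] := Ti _ _ e1f1.
  rewrite ltn_neqAle -inrank_neq // emax ?andbT; last first.
    by apply: sub; rewrite !inE eqxx orbT.
  by apply: contraNneq ne1 => ->; rewrite eqxx.
have [_ Ef1] := Ti _ _ ef1; have [_ Ef2] := Ti _ _ ef2.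
have Ef : f1 = f2.
  apply: outrank_inj => //.
  have := nc _ _ _ _ e1f1 ef2; have := nc _ _ _ _ e2f2 ef1.
  by rewrite /compatible ne2 ne1' /=; lia.
by rewrite Ef eqxx in nf.
Qed.

(** The tree contains a path from [e] to [f]. Closed up by [(e, f)], it would be a cycle in the
    still noncrossing set [T'], unless it is that single edge. *)
Lemma tree_maximal T : noncrossing_tree F i T -> maximal_noncrossing T.
Proof.
move=> [Ti [_ conn _] nc] e f Ee Ef comp.
have {nc} nc : noncrossing T by apply/noncrossingE.
pose T' := ((e, f) |: T)%SET.
have T'i : at_vertex T'.
  by move=> e' f'; rewrite !inE => /predU1P[[-> ->] //|/Ti].
have nc' : noncrossing T'.
  move=> e1 f1 e2 f2; rewrite !inE.
  move=> /predU1P[[-> ->]|T1] /predU1P[[-> ->]|T2].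
  - by rewrite /compatible ltnn.
  - exact: comp.
  - by have := comp _ _ T1; rewrite /compatible andbC.
  - exact: nc.
have /connectP[p0 p0P Ep0] : connect (tree_adj T) (inl e) (inr f).
  by apply: conn; rewrite unfold_in /= ?Ee ?Ef eqxx.
case/shortenP: p0P Ep0 => p pP pu _ Ep.
case: p pP pu Ep => [|y [|z p]] // pP pu Ep.
  by move: Ep pP => /= <-; rewrite andbT.
case: (noncrossing_acyclic T'i nc' (c := [:: inl e, y, z & p])) => //.
apply/andP; split=> //; rewrite /cycle rcons_path.
apply/andP; split.
  apply: sub_path pP => -[e1|f1] [e2|f2] //=; by rewrite !inE => ->; rewrite orbT.
by rewrite -Ep /= !inE eqxx.
Qed.

Lemma maximal_tree T :
  (exists e : edge G, tgt e = i) -> (exists f : edge G, src f = i) ->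
  at_vertex T -> noncrossing T -> maximal_noncrossing T -> noncrossing_tree F i T.
Proof.
move=> [e0 Ee0] [f0 Ef0] Ti nc mx.
have em0P : [pred e : edge G | tgt e == i] e0 by rewrite /= Ee0.
have fm0P : [pred f : edge G | src f == i] f0 by rewrite /= Ef0.
case: (arg_minnP inrank em0P) => em /eqP Eem em_min.
case: (arg_minnP outrank fm0P) => fm /eqP Efm fm_min.
have mT : (em, fm) \in T.
  apply: mx => // e f /Ti[Ee Ef]; apply/andP; split; apply/implyP.
    by move=> _; apply: fm_min; rewrite /= Ef.
  by have := em_min e; rewrite /= Ee eqxx => /(_ isT); lia.
have adj_sym : symmetric (tree_adj T) by move=> [?|?] [?|?].
have csym := sym_connect_sym adj_sym.
have left_conn e : tgt e = i -> connect (tree_adj T) (inl em) (inl e).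
  have [m] := ubnP (inrank e); elim: m e => // m IH e ltm Ee.
  have [->|nem] := eqVneq e em; first exact: connect0.
  have lt_em : inrank em < inrank e.
    by rewrite ltn_neqAle -inrank_neq // eq_sym nem em_min //= Ee.
  (* Among the pairs with left vertex below [e], one with the largest right vertex [f1] is taken:
     [(e, f1)] is then comparable with all of [T], hence in [T]. *)
  pose P := [pred g : edge G * edge G | (g \in T) && (inrank g.1 < inrank e)].
  have P0 : P (em, fm) by rewrite /= mT.
  case: (arg_maxnP (fun g => outrank g.2) P0) => -[e1 f1] /andP[/= T1 lt1] max1.
  have [Ee1 Ef1] := Ti _ _ T1.
  have T2 : (e, f1) \in T.
    apply: mx => // e2 f2 T2; apply/andP; split; apply/implyP => lt2.
      by have /andP[/implyP H _] := nc _ _ _ _ T1 T2; apply: H; lia.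
    by apply: (max1 (e2, f2)); rewrite /= T2.
  apply: connect_trans (IH e1 _ Ee1) _; first lia.
  by apply: (@connect_trans _ _ (inr f1)); apply: connect1.
have conn x : tree_vertex i x -> connect (tree_adj T) (inl em) x.
  case: x => [e|f] /= /eqP Ex; first exact: left_conn.
  (* Dually, the largest left vertex [e1] among pairs with right vertex at most [f] is adjacent to
     [f]. *)
  pose P := [pred g : edge G * edge G | (g \in T) && (outrank g.2 <= outrank f)].
  have P0 : P (em, fm) by rewrite /= mT fm_min //= Ex.
  case: (arg_maxnP (fun g => inrank g.1) P0) => -[e1 f1] /andP[/= T1 le1] max1.
  have [Ee1 Ef1] := Ti _ _ T1.
  apply: connect_trans (left_conn e1 Ee1) _; apply: connect1 => /=.
  apply: mx => // e2 f2 T2; apply/andP; split; apply/implyP => lt2.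
    rewrite leqNgt; apply/negP => lt3.
    by have := max1 (e2, f2); rewrite /= T2 (ltnW lt3) => /(_ isT); lia.
  by have /andP[_ /implyP/(_ lt2)] := nc _ _ _ _ T1 T2; lia.
split=> //; last by apply/noncrossingE.
split; [by exists (inl e0); rewrite /= Ee0| |exact: noncrossing_acyclic].
move=> x y xA yA; apply: connect_trans (conn y yA); rewrite csym; exact: conn.
Qed.

End NoncrossingTrees.

(** * Paths in the reduced graph *)

Definition parts (n : nat) (G : mgraph n.+2) (i : 'I_n.+2)
    (T : {set edge G * edge G}) (a : edge (reduced_graph i T)) : seq (edge G) :=
  match a with inl e => [:: val e] | inr ef => [:: (val ef).1; (val ef).2] end.

(** Contracting a path makes sense only if the pair it uses at [i] lies in [T]; its inverse is
    total, so all transport is phrased with the inverse. *)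
Definition expand (n : nat) (G : mgraph n.+2) (i : 'I_n.+2)
    (T : {set edge G * edge G}) (p : seq (edge (reduced_graph i T))) :
    seq (edge G) :=
  flatten [seq parts a | a <- p].

Section ReducedGraph.
Variables (n : nat) (G : mgraph n.+2) (F : framing G) (i : 'I_n.+2).
Variable T : {set edge G * edge G}.
Hypothesis G_incr : increasing_edges G.
Hypothesis F_framing : is_framing F.
Hypothesis i_inner : inner i.
Hypothesis i_first : forall e : edge G, tgt e = i -> src e = ord0.
Hypothesis T_at_i : at_vertex i T.

Local Notation G' := (reduced_graph i T).
Local Notation F' := (inheritance_framing F i T).
Implicit Types (a b : edge G') (p q : seq (edge G')) (e f : edge G).

Variant reduced_edge_spec a : Prop :=
| SurvivingEdge e of src e != i & tgt e != i & first_part a = e &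
    last_part a = e & parts a = [:: e]
| SumEdge e f of (e, f) \in T & tgt e = i & src f = i & first_part a = e &
    last_part a = f & parts a = [:: e; f].

Lemma reduced_edgeP a : reduced_edge_spec a.
Proof.
case: a => [[e He]|[[e f] Tef]].
  by case/andP: (He) => *; apply: (@SurvivingEdge _ e).
by have [*] := T_at_i Tef; apply: (@SumEdge _ e f).
Qed.

Lemma surviving_edge e : src e != i -> tgt e != i ->
  exists a, [/\ first_part a = e, last_part a = e & parts a = [:: e]].
Proof.
move=> He1 He2; have He : (src e != i) && (tgt e != i) by rewrite He1.
by exists (inl (exist _ e He)).
Qed.

Lemma sum_edge e f : (e, f) \in T ->
  exists a, [/\ first_part a = e, last_part a = f & parts a = [:: e; f]].
Proof. by move=> Tef; exists (inr (exist _ (e, f) Tef)). Qed.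

Lemma reduced_edge_ext a b :
  first_part a = first_part b -> last_part a = last_part b -> a = b.
Proof.
case: a => [[e He]|[[e f] Tef]]; case: b => [[e' He']|[[e' f'] Tef']] /=.
- by move=> Ee _; congr inl; apply: val_inj.
- move=> Ee Ef; exfalso; case/andP: (He) => _; have [Ee' _] := T_at_i Tef'.
  by rewrite Ee Ee' eqxx.
- move=> Ee Ef; exfalso; case/andP: (He') => _; have [Ee' _] := T_at_i Tef.
  by rewrite -Ee Ee' eqxx.
- by move=> Ee Ef; congr inr; apply: val_inj; rewrite /= Ee Ef.
Qed.

Lemma reduced_incr : increasing_edges G'.
Proof.
move=> a; rewrite [src a]/(src (first_part a)) [tgt a]/(tgt (last_part a)).
case: (reduced_edgeP a) => [e _ _ -> -> _|e f _ Ee Ef -> -> _]; first exact: G_incr.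
apply: ltn_trans (G_incr f); rewrite Ef -Ee; exact: G_incr.
Qed.

Lemma dpath_expand (u v : 'I_n.+2) p : dpath u v (expand p) = dpath u v p.
Proof.
elim: p u => [//|a p IH] u.
rewrite [RHS]/((src (first_part a) == u) && dpath (tgt (last_part a)) v p).
rewrite -[expand _]/(parts a ++ expand p) dpath_cat.
case: (reduced_edgeP a) => [e _ _ -> -> ->|e f _ Ee Ef -> -> ->] /=.
  by rewrite eqxx andbT IH.
by rewrite Ee Ef !eqxx !andbT /= IH.
Qed.

Lemma expand_cat p q : expand (p ++ q) = expand p ++ expand q.
Proof. by rewrite /expand map_cat flatten_cat. Qed.

(** Decoding is unambiguous: the leading edge ends at [i] exactly when it opens a sum. *)
Lemma expand_inj : injective (@expand n G i T).
Proof.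
elim=> [|a p IH] [|b q] //.
- by rewrite /expand /=; case: (reduced_edgeP b) => [e _ _ _ _ ->|e f _ _ _ _ _ ->].
- by rewrite /expand /=; case: (reduced_edgeP a) => [e _ _ _ _ ->|e f _ _ _ _ _ ->].
rewrite /expand /= -!/(expand _) => E.
suff [<- /IH <-//] : a = b /\ expand p = expand q.
case: (reduced_edgeP a) (reduced_edgeP b) E =>
    [e e1 e2 Fa La ->|e f _ e2 f1 Fa La ->];
  case=> [e' e1' e2' Fb Lb ->|e' f' _ e2' f1' Fb Lb ->] /=.
- by case=> Ee ->; split=> //; apply: reduced_edge_ext; rewrite ?Fa ?La ?Fb ?Lb.
- by case=> Ee _; rewrite Ee e2' eqxx in e2.
- by case=> Ee _; rewrite -Ee e2 eqxx in e2'.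
- by case=> Ee Ef ->; split=> //; apply: reduced_edge_ext; rewrite ?Fa ?La ?Fb ?Lb.
Qed.

Lemma expand_split p (x y : seq (edge G)) (u v : 'I_n.+2) :
  expand p = x ++ y -> dpath u v x -> v != i ->
  exists p1 p2, [/\ p = p1 ++ p2, expand p1 = x & expand p2 = y].
Proof.
move=> E xP vi; elim: p x u E xP => [|a p IH] x u E xP.
  by case: x E xP => // E _; exists [::], [::].
case: x E xP => [E _|e0 x E xP]; first by exists [::], (a :: p).
move: E; rewrite /expand /= -/(expand p).
case: (reduced_edgeP a) => [e e1 e2 Fa La Pa|e f _ e2 f1 Fa La Pa]; rewrite Pa.
  move=> [Ee E]; case/andP: xP => _ xP.
  have [p1 [p2 [-> E1 E2]]] := IH _ _ E xP.
  by exists (a :: p1), p2; rewrite /expand /= Pa -!/(expand _) E1 E2 Ee.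
case: x xP => [|f0 x] xP [Ee].
  by move: xP => /= /andP[_]; rewrite -Ee e2 eq_sym (negPf vi).
move=> [Ef E]; case/and3P: xP => _ _ xP.
have [p1 [p2 [-> E1 E2]]] := IH _ _ E xP.
by exists (a :: p1), p2; rewrite /expand /= Pa -!/(expand _) E1 E2 Ee Ef.
Qed.

Lemma expand_onto (x : seq (edge G)) (u v : 'I_n.+2) :
  dpath u v x -> u != i -> v != i ->
  (forall y e f z, x = y ++ [:: e, f & z] -> tgt e = i -> (e, f) \in T) ->
  exists p, expand p = x.
Proof.
have [m] := ubnP (size x); elim: m x u => // m IH [|e x] u ltm xP ui vi xT.
  by exists [::].
have [Ee|ne] := eqVneq (tgt e) i; last first.
  case/andP: xP => /eqP Eu xP.
  have [p Ep] : exists p, expand p = x.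
    apply: IH xP ne vi _ => // y e' f z Ex.
    by apply: (xT (e :: y) _ _ z); rewrite Ex.
  have [|//|a [_ _ Pa]] := @surviving_edge e; first by rewrite Eu.
  by exists (a :: p); rewrite /expand /= Pa -/(expand p) Ep.
case: x ltm xP xT => [|f x] ltm xP xT.
  by move: xP => /= /andP[_]; rewrite Ee eq_sym (negPf vi).
have Tef : (e, f) \in T by apply: (xT [::] _ _ x).
have [_ Ef] := T_at_i Tef.
case/and3P: xP => _ _ xP.
have [p Ep] : exists p, expand p = x.
  apply: IH xP _ vi _; first exact: ltnW.
    by have := G_incr f; rewrite Ef => lt; apply: contraTneq lt => ->; rewrite ltnn.
  by move=> y e' f' z Ex; apply: (xT [:: e, f & y] _ _ z); rewrite Ex.
have [a [_ _ Pa]] := sum_edge Tef.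
by exists (a :: p); rewrite /expand /= Pa -/(expand p) Ep.
Qed.

Lemma last_part_eq a b : last_part a = last_part b -> a != b ->
  tgt (first_part a) = i /\ tgt (first_part b) = i.
Proof.
case: (reduced_edgeP a) (reduced_edgeP b) => [e e1 e2 Fa La _|e f _ e2 f1 Fa La _];
  case=> [e' e1' e2' Fb Lb _|e' f' _ e2' f1' Fb Lb _]; rewrite La Lb ?Fa ?Fb.
- by move=> E /eqP[]; apply: reduced_edge_ext; rewrite ?Fa ?La ?Fb ?Lb.
- by move=> E; rewrite E f1' eqxx in e1.
- by move=> E; rewrite -E f1 eqxx in e1'.
- by [].
Qed.

Lemma first_part_eq a b : first_part a = first_part b -> a != b ->
  [/\ parts a = [:: first_part a; last_part a],
      parts b = [:: first_part b; last_part b],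
      src (last_part a) = i & src (last_part b) = i].
Proof.
case: (reduced_edgeP a) (reduced_edgeP b) => [e e1 e2 Fa La ->|e f _ e2 f1 Fa La ->];
  case=> [e' e1' e2' Fb Lb ->|e' f' _ e2' f1' Fb Lb ->]; rewrite La Lb ?Fa ?Fb.
- by move=> E /eqP[]; apply: reduced_edge_ext; rewrite ?Fa ?La ?Fb ?Lb.
- by move=> E; rewrite E e2' eqxx in e2.
- by move=> E; rewrite -E e2 eqxx in e2'.
- by [].
Qed.

Lemma parts_last a : exists x, parts a = rcons x (last_part a).
Proof.
by case: (reduced_edgeP a) => [e _ _ _ -> ->|e f _ _ _ _ -> ->];
  [exists [::]|exists [:: e]].
Qed.

Lemma parts_first a : exists x, parts a = first_part a :: x.
Proof.
by case: (reduced_edgeP a) => [e _ _ -> _ ->|e f _ _ _ -> _ ->];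
  [exists [::]|exists [:: f]].
Qed.

Lemma parts_sum a : tgt (first_part a) = i ->
  parts a = [:: first_part a; last_part a] /\ (first_part a, last_part a) \in T.
Proof.
case: (reduced_edgeP a) => [e _ e2 -> _ _ E|e f Tef _ _ -> -> -> //].
by rewrite E eqxx in e2.
Qed.

(** Distinct edges with the same last part are sums; expansion moves their divergence back to [i],
    where the inherited order already compares first parts. *)
Lemma initial_le_expand p q :
  initial_le F' p q -> initial_le F (expand p) (expand q).
Proof.
case=> [->|[p' [q' [s [a [b [-> -> nab /=]]]]]]]; first by left.
rewrite !expand_cat; case: eqP => [Eab|/eqP nl] le_ab; right.
  have [Ea Eb] := last_part_eq Eab nab.
  have [Pa _] := parts_sum Ea; have [Pb _] := parts_sum Eb.
  exists (expand p'), (expand q'), (last_part a :: expand s),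
    (first_part a), (first_part b).
  rewrite /expand /= Pa Pb /= Eab; split=> //.
  apply: contraNneq nab => Ef; apply/eqP; exact: reduced_edge_ext.
have [x Pa] := parts_last a; have [y Pb] := parts_last b.
exists (expand p' ++ x), (expand q' ++ y), (expand s), (last_part a), (last_part b).
by rewrite /expand /= Pa Pb !cat_rcons !catA.
Qed.

Lemma final_le_expand p q : final_le F' p q -> final_le F (expand p) (expand q).
Proof.
case=> [->|[s [p' [q' [a [b [-> -> nab /=]]]]]]]; first by left.
rewrite !expand_cat; case: eqP => [Eab|/eqP nl] le_ab; right.
  have [Pa Pb _ _] := first_part_eq Eab nab.
  exists (expand s ++ [:: first_part a]), (expand p'), (expand q'),
    (last_part a), (last_part b).
  rewrite /expand /= Pa Pb /= Eab -!catA; split=> //.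
  apply: contraNneq nab => Ef; apply/eqP; exact: reduced_edge_ext.
have [x Pa] := parts_first a; have [y Pb] := parts_first b.
exists (expand s), (x ++ expand p'), (y ++ expand q'), (first_part a), (first_part b).
by rewrite /expand /= Pa Pb.
Qed.

(** Sums start at the source, so edges leaving an inner vertex are old ones in their old order;
    incoming edges are ordered lexicographically by last part, ties being resolved by the linear
    order at [i]. *)
Lemma reduced_framing : is_framing F'.
Proof.
move=> v v_in; have [[refl anti trans tot] [orefl oanti otrans otot]] := F_framing v_in.
have [[refl1 anti1 trans1 tot1] _] := F_framing i_inner.
have tgtE a : tgt a = tgt (last_part a) by [].
have srcE a : src a = src (first_part a) by [].
split; last first.
  have outP a : src a == v -> first_part a = last_part a.
    rewrite srcE; case: (reduced_edgeP a) => [e _ _ -> ->//|e f _ Ee _ -> _ _].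
    by rewrite (i_first Ee) => /eqP E; move: v_in; rewrite -E.
  split.
  - move=> a; rewrite inE => av /=.
    by rewrite eqxx -(outP a av); apply: orefl; rewrite inE -srcE.
  - move=> a b; rewrite !inE => av bv /=; rewrite eq_sym.
    case: eqP => [E _|_ le]; apply: reduced_edge_ext;
      rewrite -?(outP _ av) -?(outP _ bv) //.
      by apply: oanti => //; rewrite inE -srcE.
    by apply: oanti => //; rewrite inE -srcE.
  - move=> b a c; rewrite !inE => bv av cv /=.
    rewrite -(outP a av) -(outP b bv) -(outP c cv) !if_same.
    by apply: otrans; rewrite inE -srcE.
  - move=> a b; rewrite !inE => av bv /=.
    rewrite -(outP a av) -(outP b bv) !if_same.
    by apply: otot; rewrite inE -srcE.
have lE a b : (last_part a == last_part b) -> a != b ->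
    (first_part a \in [pred e | tgt e == i]) && (first_part b \in [pred e | tgt e == i]).
  move=> /eqP Eab nab; rewrite !inE.
  by have [-> ->] := last_part_eq Eab nab; rewrite eqxx.
have rfl a : tgt a == v -> in_le F (first_part a) (first_part a).
  rewrite tgtE; case: (reduced_edgeP a) => [e _ _ -> -> _|e f _ e2 f1 -> _ _] av.
    exact: refl.
  by apply: refl1; rewrite inE e2.
have mem a : tgt a == v -> last_part a \in [pred e | tgt e == v] by rewrite tgtE inE.
split.
- by move=> a; rewrite inE => av /=; rewrite eqxx; apply: rfl.
- move=> a b; rewrite !inE => av bv /=; rewrite eq_sym.
  have [//|nab] := eqVneq a b; case: eqP => [/esym E|nE] le.
    have /andP[fa fb] := lE a b (introT eqP E) nab.
    by apply: reduced_edge_ext => //; apply: anti1.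
  by case: nE; apply/esym; apply: anti; rewrite ?mem.
- move=> b a c; rewrite !inE => bv av cv /=.
  have [->|nab] := eqVneq a b; first by rewrite eqxx.
  have [->|nbc] := eqVneq b c; first by rewrite eqxx.
  have [->|nac] := eqVneq a c; first by rewrite eqxx => _ _; apply: rfl.
  case: (eqVneq (last_part a) (last_part b)) => [Eab|lab];
    case: (eqVneq (last_part b) (last_part c)) => [Ebc|lbc].
  + rewrite Eab Ebc eqxx.
    have /andP[fa fb] := lE a b (introT eqP Eab) nab.
    have /andP[_ fc] := lE b c (introT eqP Ebc) nbc.
    exact: trans1.
  + by rewrite Eab (negPf lbc).
  + by rewrite -Ebc (negPf lab).
  + case: eqP => [Eac|_]; last by apply: trans; rewrite mem.
    rewrite -Eac => le1 le2; case/eqP: lab; apply: anti; rewrite ?mem //.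
    by rewrite le1.
- move=> a b; rewrite !inE => av bv /=; rewrite (eq_sym (last_part b)).
  have [->|nab] := eqVneq a b; first by rewrite eqxx rfl.
  case: eqP => [E|_]; last by apply: tot; rewrite mem.
  have /andP[fa fb] := lE a b (introT eqP E) nab.
  exact: tot1.
Qed.

End ReducedGraph.

(** * Maximal cliques under reduction *)

Local Open Scope classical_set_scope.

Lemma maximal_clique_add (n : nat) (G : mgraph n.+2) (F : framing G)
    (C : set (seq (edge G))) (x : seq (edge G)) :
  increasing_edges G -> maximal_clique F C -> route x ->
  (forall y, C y -> coherent F x y) -> C x.
Proof.
move=> G_incr [[Croute Ccoh] Cmax] xP xC.
rewrite -(Cmax (C `|` [set x])); [by right| |by move=> y; left].
split=> [y [/Croute//|->//]|y z [Cy|->] [Cz|->]].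
- exact: Ccoh.
- by move=> v v_in; apply: coherent_at_sym; apply: xC.
- exact: xC.
- by move=> v v_in; apply: coherent_at_refl.
Qed.


Section FirstVertex.
Variables (n : nat) (G : mgraph n.+2) (F : framing G) (i : 'I_n.+2).
Hypothesis G_incr : increasing_edges G.
Hypothesis F_framing : is_framing F.
Hypothesis G_ext : forall e : edge G, inner (tgt e) -> exists f : edge G, src f = tgt e.
Hypothesis i_inner : inner i.
Hypothesis i_first : forall e : edge G, tgt e = i -> src e = ord0.
Implicit Types (T : {set edge G * edge G}) (C D : set (seq (edge G))).
Implicit Types (x y r : seq (edge G)) (e f : edge G) (v : 'I_n.+2).

Lemma i_bounds : 0 < i < n.+1. Proof. by rewrite -innerE. Qed.

Lemma dpath_to_first x : dpath ord0 i x -> exists2 e, x = [:: e] & tgt e = i.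
Proof.
elim/last_ind: x => [/eqP E|x e _]; first by move: i_bounds; rewrite -E.
rewrite -cats1 => xP; have Ee : tgt e = i.
  by move: (dpath_end xP); rewrite /path_end map_cat last_cat.
exists e => //; move: xP => /dpath_cat_l -/(_ ord0).
by rewrite /= i_first // Ee !eqxx => /(_ isT) /(dpath_loop G_incr) ->.
Qed.

Lemma dpath_from_first x : dpath i ord_max x -> exists f y, x = f :: y.
Proof.
case: x => [/eqP E|f y _]; last by exists f, y.
by move: i_bounds; rewrite E /= ltnn.
Qed.

Lemma initial_le_cons e f e' :
  initial_le F [:: e; f] [:: e'; f] -> initial_le F [:: e] [:: e'].
Proof. by rewrite !initial_leE => /(div_le_cat _ [:: f] [:: e]). Qed.

Lemma final_le_cons f x y : final_le F x y -> final_le F (f :: x) (f :: y).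
Proof. by move=> le_xy; apply/(div_le_cat _ [:: f]). Qed.

(* Routes that leave [i] along a common edge are compared at its end. *)
Lemma coherent_at_first e f r e' f' r' :
  tgt e = i -> tgt e' = i -> dpath i ord_max (f :: r) -> dpath i ord_max (f' :: r') ->
  compatible F i e f e' f' ->
  (f = f' -> inner (tgt f) ->
     coherent_at F (tgt f) [:: e, f & r] [:: e', f' & r']) ->
  coherent_at F i [:: e, f & r] [:: e', f' & r'].
Proof.
move=> Ee Ee' fP fP' comp cohf x1 x2 y1 y2 Ex Ey x1P x2P y1P y2P.
have [e1 E1 _] := dpath_to_first x1P; have [e1' E1' _] := dpath_to_first y1P.
move: Ex Ey x1P y1P {x2P y2P}; rewrite E1 E1' => -[<- <-] [<- <-] eP eP'.
have [i_gt0 i_lt] := andP i_bounds.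
have [Eee|nee] := eqVneq e e'.
  rewrite Eee; case: (final_le_total G_incr F_framing i_gt0 fP fP') => le_f.
    by left; split=> //; left.
  by right; split=> //; left.
have [/andP[/eqP fi rP] /andP[/eqP fi' rP']] := (fP, fP').
(* With distinct edges on both sides, comparability of the pairs is strict in both coordinates and
   settles both orders. *)
have [Eff|nff] := eqVneq f f'; last first.
  move: (nee) (nff); rewrite (inrank_neq F_framing i_inner) //.
  rewrite (outrank_neq F_framing i_inner) //.
  case/andP: comp => /implyP c1 /implyP c2 ne1 ne2.
  have [lt_e|ge_e] := ltnP (rank [pred e | tgt e == i] (in_le F) e)
     (rank [pred e | tgt e == i] (in_le F) e').
    left; split; right.
      by exists [::], [::], [::], e, e'; rewrite (in_le_rank F_framing i_inner) // ltnW.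
    by exists [::], r, r', f, f'; rewrite (out_le_rank F_framing i_inner) // c1.
  have lt_e : rank [pred e | tgt e == i] (in_le F) e'
     < rank [pred e | tgt e == i] (in_le F) e by lia.
  right; split; right.
    by exists [::], [::], [::], e', e; rewrite (in_le_rank F_framing i_inner) // eq_sym.
  by exists [::], r', r, f', f; rewrite (out_le_rank F_framing i_inner) // c2 // eq_sym.
have [Em|nem] := eqVneq (tgt f) ord_max.
  move: rP rP'; rewrite -Eff Em => /(dpath_loop G_incr) -> /(dpath_loop G_incr) ->.
  case: (initial_le_total G_incr F_framing i_lt eP eP') => le_e.
    by left; split=> //; left.
  by right; split=> //; left.
have f_in : inner (tgt f).
  by rewrite /inner nem andbT -val_eqE /=; have := G_incr f; lia.
have := cohf Eff f_in [:: e; f] r [:: e'; f'] r' erefl erefl.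
move: rP'; rewrite /= -Eff => rP'.
rewrite (i_first Ee) (i_first Ee') Ee Ee' fi !eqxx => /(_ isT rP isT rP').
by case=> -[/initial_le_cons le1 /(final_le_cons f) le2]; [left|right].
Qed.

Definition clique_pairs C : {set edge G * edge G} :=
  [set ef : edge G * edge G |
    (tgt ef.1 == i) && `[< exists r, C [:: ef.1, ef.2 & r] >]]%SET.

Lemma clique_pairsP C e f :
  (e, f) \in clique_pairs C <-> tgt e = i /\ exists r, C [:: e, f & r].
Proof.
rewrite inE /=; split=> [/andP[/eqP ? /asboolP]//|[-> exr]].
by rewrite eqxx; apply/asboolP.
Qed.

Lemma clique_pairs_at C : clique F C -> at_vertex i (clique_pairs C).
Proof.
move=> [Croute _] e f /clique_pairsP[Ee [r /Croute /and3P[_ /eqP Ef _]]].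
by rewrite Ef Ee.
Qed.

Lemma route_first e f r : tgt e = i -> route [:: e, f & r] ->
  dpath ord0 i [:: e] /\ dpath i ord_max (f :: r).
Proof. by move=> Ee /= /andP[-> fP]; rewrite /= Ee eqxx; split=> //; rewrite -Ee. Qed.

Lemma clique_pairs_noncrossing C : clique F C -> noncrossing F i (clique_pairs C).
Proof.
move=> CF; have [Croute Ccoh] := CF; have Ti := clique_pairs_at CF.
apply/(noncrossingE F_framing i_inner Ti) => p q t u pqT tuT.
have [[Ep Eq] [Et Eu]] := (Ti _ _ pqT, Ti _ _ tuT).
move: pqT tuT => /clique_pairsP[_ [r Cr]] /clique_pairsP[_ [r' Cr']].
have [pP qP] := route_first Ep (Croute _ Cr).
have [tP uP] := route_first Et (Croute _ Cr').
have [[_ ianti _ _] [_ oanti _ _]] := F_framing i_inner.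
move=> [npt le_pt nuq le_uq].
have := Ccoh _ _ Cr Cr' i i_inner [:: p] _ [:: t] _ erefl erefl pP qP tP uP.
case=> -[le1 le2].
  rewrite eq_sym in nuq; move: (div_le_cons nuq le2) => le3.
  by case/eqP: nuq; apply: oanti; rewrite ?inE ?Eq ?Eu ?le_uq ?le3.
move: le1; rewrite initial_leE eq_sym in npt * => /(div_le_cons npt) le3.
by case/eqP: npt; apply: ianti; rewrite ?inE ?Ep ?Et ?le_pt ?le3.
Qed.

(** The path [[:: e; f]] extends to a route coherent with [C] from [tgt f] on. The only inner vertex
    it meets earlier is [i], where comparability of pairs takes over, so maximality puts the route
    in [C]. *)
Lemma clique_pairs_maximal C :
  maximal_clique F C -> maximal_noncrossing F i (clique_pairs C).
Proof.
move=> Cmax e f Ee Ef comp; have CF := Cmax.1; have [Croute Ccoh] := CF.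
have efP : dpath ord0 (tgt f) [:: e; f] by rewrite /= i_first // Ee Ef !eqxx.
have [//|r rP rC] := extend_to_coherent_route G_incr F_framing G_ext CF _ efP.
apply/clique_pairsP; split=> //; exists r.
have fP : dpath i ord_max (f :: r) by rewrite /= Ef eqxx.
apply: (maximal_clique_add G_incr Cmax); first exact: (dpath_catI efP rP).
move=> y Cy v v_in; have [->|nvi] := eqVneq v i; last first.
  move=> x1 x2 y1 y2 Ex Ey x1P x2P y1P y2P.
  apply: (rC y v Cy v_in) => //.
  case: x1 Ex x1P {x2P} => [|e1 [|f1 x1]] /=.
  - by move=> _ /eqP E; move: v_in; rewrite -E.
  - by move=> [<- _] /andP[_]; rewrite Ee eq_sym (negPf nvi).
  - by move=> [_ <- _] /and3P[_ _ /(dpath_le G_incr)].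
move=> x1 x2 y1 y2 Ex Ey x1P x2P y1P y2P.
have [e' Ey1 Ee'] := dpath_to_first y1P.
have [f' [r' Ey2]] := dpath_from_first y2P.
rewrite Ey Ey1 Ey2 /= in Cy *; rewrite Ey1 in y1P; rewrite Ey2 in y2P.
have coh : coherent_at F i [:: e, f & r] [:: e', f' & r'].
  apply: coherent_at_first => //; last by move=> _ f_in; apply: rC.
  by apply: comp; apply/clique_pairsP; split=> //; exists r'.
exact: coh.
Qed.

(** * Coherence and cliques across the contraction *)

Section Correspondence.
Variable T : {set edge G * edge G}.
Hypothesis T_at_i : at_vertex i T.
Local Notation G' := (reduced_graph i T).
Local Notation F' := (inheritance_framing F i T).
Implicit Types (a b : edge G') (p q : seq (edge G')).

Let G'_incr : increasing_edges G' := reduced_incr G_incr T_at_i.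
Let F'_framing : is_framing F' := reduced_framing F_framing i_inner i_first T_at_i.

Lemma reduced_ext a : inner (tgt a) -> exists b, src b = tgt a.
Proof.
rewrite [tgt a]/(tgt (last_part a)) => a_in; have [g gP] := G_ext a_in.
have [||b [bP _ _]] := @surviving_edge n G i T g.
- rewrite gP; case: (reduced_edgeP T_at_i a) => [e _ ne _ -> _//|e f _ _ Ef _ -> _].
  by have := G_incr f; rewrite Ef => lt; apply: contraTneq lt => ->; rewrite ltnn.
- by apply/eqP => /i_first; apply/eqP; rewrite gP; case/andP: a_in.
by exists b; apply: etrans gP; rewrite -bP.
Qed.

(** Expansion preserves the order; it also reflects it, because the order is total in the reduced
    graph and antisymmetric in [G]. *)
Lemma initial_le_reduce v p q : v < n.+1 -> dpath ord0 v p -> dpath ord0 v q ->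
  initial_le F (expand p) (expand q) -> initial_le F' p q.
Proof.
move=> v_in pP qP le_pq.
have [//|/(initial_le_expand T_at_i) le_qp] :=
  initial_le_total G'_incr F'_framing v_in pP qP.
left; apply: (expand_inj T_at_i).
by apply: (initial_le_anti G_incr F_framing v_in) => //; rewrite dpath_expand.
Qed.

Lemma final_le_reduce v p q : 0 < v -> dpath v ord_max p -> dpath v ord_max q ->
  final_le F (expand p) (expand q) -> final_le F' p q.
Proof.
move=> v_in pP qP le_pq.
have [//|/(final_le_expand T_at_i) le_qp] :=
  final_le_total G'_incr F'_framing v_in pP qP.
left; apply: (expand_inj T_at_i).
by apply: (final_le_anti G_incr F_framing v_in) => //; rewrite dpath_expand.
Qed.

Lemma coherent_reduce p q : coherent F (expand p) (expand q) -> coherent F' p q.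
Proof.
move=> coh v v_in p1 p2 q1 q2 Ep Eq p1P p2P q1P q2P.
have /andP[v_gt0 v_lt] : 0 < v < n.+1 by rewrite -innerE.
have := coh v v_in (expand p1) (expand p2) (expand q1) (expand q2).
rewrite Ep Eq !expand_cat !dpath_expand //.
case=> // -[/(initial_le_reduce v_lt) le1 /(final_le_reduce v_gt0) le2]; [left|right];
  by split; auto.
Qed.

(** A cut at a vertex other than [i] comes from a cut in the reduced graph. The vertex [i] is
    invisible there, and coherence at it follows from the noncrossing pairs and coherence at the
    next vertex. *)
Lemma coherent_expand p q : noncrossing F i T -> coherent F' p q ->
  coherent F (expand p) (expand q).
Proof.
move=> nc coh.
have coh_ne v : inner v -> v != i -> coherent_at F v (expand p) (expand q).
  move=> v_in vi x1 x2 y1 y2 Ex Ey x1P x2P y1P y2P.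
  have [p1 [p2 [Ep E1 E2]]] := expand_split T_at_i Ex x1P vi.
  have [q1 [q2 [Eq E1' E2']]] := expand_split T_at_i Ey y1P vi.
  have := coh v v_in _ _ _ _ Ep Eq.
  rewrite -!(dpath_expand T_at_i) E1 E2 E1' E2' => /(_ x1P x2P y1P y2P).
  rewrite -E1 -E2 -E1' -E2'.
  by case=> -[/(initial_le_expand T_at_i) le1 /(final_le_expand T_at_i) le2];
    [left|right].
move=> v v_in; have [->{v v_in}|] := eqVneq v i; last exact: coh_ne.
move=> x1 x2 y1 y2 Ex Ey x1P x2P y1P y2P.
have [e Ex1 Ee] := dpath_to_first x1P; have [f [r Ex2]] := dpath_from_first x2P.
have [e' Ey1 Ee'] := dpath_to_first y1P; have [f' [r' Ey2]] := dpath_from_first y2P.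
have pairT (s : seq (edge G')) g h t :
    expand s = [:: g, h & t] -> tgt g = i -> (g, h) \in T.
  case: s => [//|a s] E Eg; move: E; rewrite -[expand _]/(parts a ++ expand s).
  case: (reduced_edgeP T_at_i a) => [k _ nk _ _ ->|k l Tkl _ _ _ _ ->] /=.
    by case=> Ek _; rewrite Ek Eg eqxx in nk.
  by case=> <- <- _.
have Epx : expand p = [:: e, f & r] by rewrite Ex Ex1 Ex2.
have Eqx : expand q = [:: e', f' & r'] by rewrite Ey Ey1 Ey2.
rewrite Ex2 in x2P; rewrite Ey2 in y2P.
have fi : src f = i by case/andP: x2P => /eqP.
have : coherent_at F i (expand p) (expand q).
  rewrite Epx Eqx; apply: coherent_at_first => //.
    by apply: nc; [apply: pairT Epx Ee|apply: pairT Eqx Ee'].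
  move=> _ f_in; rewrite -Epx -Eqx; apply: coh_ne => //.
  by have := G_incr f; rewrite fi => lt; apply: contraTneq lt => ->; rewrite ltnn.
by apply=> //; rewrite ?Ex2 ?Ey2.
Qed.

Lemma route_expand p : route (expand p) = route p.
Proof. exact: dpath_expand. Qed.

Lemma clique_expand (C' : set (seq (edge G'))) :
  noncrossing F i T -> clique F' C' -> clique F (@expand n G i T @` C').
Proof.
move=> nc [C'route C'coh]; split=> [_ [p /C'route pP <-]|_ _ [p Cp <-] [q Cq <-]].
  by rewrite route_expand.
by apply: coherent_expand => //; apply: C'coh.
Qed.

Definition reduced_clique C : set (seq (edge G')) :=
  [set p | C (expand p)].

Lemma clique_reduced C : clique F C -> clique F' (reduced_clique C).
Proof.
move=> [Croute Ccoh]; split=> [p /Croute|p q Cp Cq].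
  by rewrite route_expand.
by apply: coherent_reduce; apply: Ccoh.
Qed.

Lemma expand_reduced_clique C : clique F C ->
  (forall e f, (e, f) \in clique_pairs C -> (e, f) \in T) ->
  @expand n G i T @` reduced_clique C = C.
Proof.
move=> [Croute _] sub; apply/seteqP; split=> [_ [p Cp <-] //|x Cx].
have xP := Croute x Cx.
have [|||p Ep] := expand_onto G_incr T_at_i xP.
- by move: i_bounds; apply: contraTneq => <-.
- by move: i_bounds; apply: contraTneq => <-; rewrite /= ltnn.
- move=> y e f z Ex Ee; apply: sub; apply/clique_pairsP; split=> //.
  move: xP; rewrite Ex -cat_rcons /route dpath_cat => /andP[eP _].
  have : dpath ord0 i (rcons y e).
    by move: eP; rewrite /path_end map_rcons last_rcons Ee.
  move=> /dpath_to_first[e' Ey _].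
  by exists z; move: Cx; rewrite Ex; case: y Ey {Ex eP} => [|? []].
by exists p => //; rewrite /reduced_clique /= Ep.
Qed.

End Correspondence.

(** * Transport of maximality *)

Hypothesis i_in : exists e : edge G, tgt e = i.
Hypothesis i_out : exists f : edge G, src f = i.

Lemma maximal_clique_reduced C : maximal_clique F C ->
  exists T, noncrossing_tree F i T /\
  exists C' : set (seq (edge (reduced_graph i T))),
    maximal_clique (inheritance_framing F i T) C' /\ C = @expand n G i T @` C'.
Proof.
move=> Cmax; have [CF Cm] := Cmax.
have [T [Ti nc mx sub]] : exists T, [/\ at_vertex i T, noncrossing F i T,
    maximal_noncrossing F i T &
    forall e f, (e, f) \in clique_pairs C -> (e, f) \in T].
  exists (clique_pairs C); split=> //; [exact: clique_pairs_at
    |exact: clique_pairs_noncrossing|exact: clique_pairs_maximal].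
exists T; split; first exact: maximal_tree.
exists (@reduced_clique T C); have Eexp := expand_reduced_clique Ti CF sub.
split=> //; split; first exact: clique_reduced.
(* The expansion of [D] is a clique containing [C], hence equal to [C]. *)
move=> D DF subD; apply/seteqP; split=> // p Dp.
rewrite /reduced_clique /= -(Cm _ (clique_expand Ti nc DF)).
  by exists p.
by rewrite -{1}Eexp; apply: image_subset.
Qed.

(** Let a clique [D] contain the expansion. Each pair of [T] is used by [D], since its sum extends
    to a route of [C']. Pairs of [D] are thus comparable with all of [T] and lie in [T], so [D]
    contracts to a clique containing [C']. *)
Lemma maximal_clique_expand T (C' : set (seq (edge (reduced_graph i T)))) :
  noncrossing_tree F i T -> maximal_clique (inheritance_framing F i T) C' ->
  maximal_clique F (@expand n G i T @` C').
Proof.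
move=> tree C'max; have [Ti _ ncT] := tree; have [C'F C'm] := C'max.
have nc : noncrossing F i T by apply/(noncrossingE F_framing i_inner Ti).
split; first exact: clique_expand.
move=> D DF sub; have [C'route _] := C'F.
have G'_incr := reduced_incr G_incr Ti.
have F'_framing := reduced_framing F_framing i_inner i_first Ti.
have subT e f : (e, f) \in T -> (e, f) \in clique_pairs D.
  move=> Tef; have [Ee Ef] := Ti _ _ Tef.
  have [a [Fa La Pa]] := sum_edge i Tef.
  have aP : dpath ord0 (tgt a) [:: a].
    rewrite -[dpath _ _ _]/((src (first_part a) == ord0) && (tgt a == tgt a)).
    by rewrite Fa i_first // !eqxx.
  have [//|r rP rC] :=
    extend_to_coherent_route G'_incr F'_framing (@reduced_ext _ Ti) C'F _ aP.
  apply/clique_pairsP; split=> //; exists (expand r).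
  apply: sub; exists (a :: r); last by rewrite /expand /= Pa.
  apply: (maximal_clique_add G'_incr C'max); first exact: (dpath_catI aP rP).
  move=> q C'q v v_in x1 x2 y1 y2 Ex Ey x1P x2P y1P y2P.
  apply: (rC q v C'q v_in) => //.
  case: x1 Ex x1P {x2P} => [_ /eqP E|b x1 [<- _] /andP[_ /(dpath_le G'_incr)//]].
  by move: v_in; rewrite -E.
have ncD := clique_pairs_noncrossing DF.
have subD e f : (e, f) \in clique_pairs D -> (e, f) \in T.
  move=> Def; have [Ee Ef] := clique_pairs_at DF Def.
  apply: (tree_maximal F_framing i_inner tree) => // e' f' /subT.
  exact: ncD.
have ED := expand_reduced_clique Ti DF subD.
rewrite -ED; congr (_ @` _); apply: C'm; first exact: clique_reduced.
by move=> p C'p; apply: sub; exists p.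
Qed.

End FirstVertex.

(** * Flows and the induction *)

Import GRing.Theory Num.Theory.
Local Open Scope ring_scope.

Section LiftFlow.
Variables (R : realType) (n : nat) (G : mgraph n.+2) (i : 'I_n.+2).
Variable T : {set edge G * edge G}.
Hypothesis G_incr : increasing_edges G.
Hypothesis T_at_i : at_vertex i T.
Local Notation G' := (reduced_graph i T).
Local Notation lift := (lift_flow (R := R) (i := i) (T := T)).

(** The two parts of a sum differ, as a common edge would be a loop at [i]; so the disjunction loses
    no multiplicity. *)
Lemma count_expand (e : edge G) (p : seq (edge G')) :
  count (fun a : edge G' => (first_part a == e) || (last_part a == e)) p =
  count_mem e (expand p).
Proof.
elim: p => [//|a p IH]; rewrite -[expand _]/(parts a ++ expand p) count_cat -IH.
rewrite -[count _ (a :: p)]/((((first_part a == e) || (last_part a == e)) : nat) + _)%N.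
congr (_ + _)%N.
case: (reduced_edgeP T_at_i a) => [g _ _ -> -> ->|g h _ Eg Eh -> -> ->] /=.
  by rewrite orbb addn0.
case: (eqVneq g e) => [Ege|_]; last by rewrite addn0.
case: (eqVneq h e) => [Ehe|_]; last by rewrite addn0.
by have := G_incr e; rewrite -{1}Ehe Eh -Ege Eg ltnn.
Qed.

Lemma lift_unit_flow (p : seq (edge G')) : route p ->
  lift (unit_flow R p) = unit_flow R (expand p).
Proof.
move=> pP; apply/ffunP => e; rewrite !ffunE.
under eq_bigr do rewrite ffunE.
have up : uniq p := dpath_uniq (reduced_incr G_incr T_at_i) pP.
have ue : uniq (expand p).
  by apply: (dpath_uniq G_incr (u := ord0) (v := ord_max)); rewrite dpath_expand.
rewrite -(count_uniq_mem e ue) -count_expand -natr_sum; congr (_%:R).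
rewrite -sum1_count -big_mkcondr /= (eq_bigl (fun a => (a \in p) &&
  ((first_part a == e) || (last_part a == e)))); last by move=> a; rewrite andbC.
by rewrite big_mkcondr /= -big_uniq //= -big_mkcond.
Qed.

Lemma lift_convex_hull (A : set {ffun edge G' -> R}) :
  lift @` convex_hull A = convex_hull (lift @` A).
Proof.
have liftE k (t : 'I_k -> R) (a : 'I_k -> {ffun edge G' -> R})
      (x : {ffun edge G' -> R}) e :
    (forall g, x g = \sum_j t j * a j g) -> lift x e = \sum_j t j * lift (a j) e.
  move=> Ex; rewrite ffunE; under eq_bigr do rewrite Ex.
  rewrite exchange_big /=; apply: eq_bigr => j _.
  by rewrite ffunE mulr_sumr.
apply/seteqP; split=> [_ [x [k [t [a [t0 t1 Aa Ex]]]] <-]|y [k [t [b [t0 t1 Ab Ey]]]]].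
  exists k, t, (fun j => lift (a j)); split=> // [j|e]; first by exists (a j).
  exact: liftE.
have /choice[a aP] : forall j, exists x, A x /\ lift x = b j.
  by move=> j; have [x] := Ab j; exists x.
exists [ffun g => \sum_j t j * a j g].
  by exists k, t, a; split=> // [j|g]; rewrite ?ffunE //; case: (aP j).
apply/ffunP => e; rewrite Ey (@liftE _ t a); last by move=> g; rewrite ffunE.
by apply: eq_bigr => j _; case: (aP j) => _ ->.
Qed.

Lemma lift_hull_expand (C : set (seq (edge G'))) : (forall p, C p -> route p) ->
  convex_hull (@unit_flow R n.+2 G @` (@expand n G i T @` C)) =
  lift @` convex_hull (@unit_flow R n.+2 G' @` C).
Proof.
move=> Croute; rewrite lift_convex_hull; congr convex_hull.
apply/seteqP; split=> [_ [_ [p Cp <-] <-]|_ [_ [p Cp <-] <-]].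
  by exists (unit_flow R p); [exists p|rewrite lift_unit_flow //; apply: Croute].
by exists (expand p); [exists p|rewrite lift_unit_flow //; apply: Croute].
Qed.

End LiftFlow.

(** * Base case: parallel edges from source to sink *)

Section NoInnerVertex.
Variables (R : realType) (n : nat) (G : mgraph n.+2) (F : framing G).
Hypothesis src0 : forall e : edge G, src e = ord0.
Hypothesis tgt_max : forall e : edge G, tgt e = ord_max.

Lemma route_singleton (p : seq (edge G)) : route p -> exists e, p = [:: e].
Proof.
case: p => [//|e [|f p]] /=; first by exists e.
by rewrite /route /= !src0 !tgt_max.
Qed.

Lemma singleton_route (e : edge G) : route [:: e].
Proof. by rewrite /route /= src0 tgt_max !eqxx. Qed.

(** A route is a single edge and meets no inner vertex, so coherence is void. *)
Lemma maximal_clique_routes : maximal_clique F = [set [set p | route p]].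
Proof.
have routes : clique F [set p | route p].
  split=> // p q pP qP v v_in p1 p2 q1 q2 Ep _ p1P p2P.
  have [e Ee] := route_singleton pP; move: Ep p1P p2P; rewrite Ee.
  case: p1 => [_ /eqP E|e1 [|? ?]] //; first by move: v_in; rewrite -E.
  by move=> _ /= /andP[_ /eqP E]; move: v_in; rewrite -E tgt_max /inner eqxx andbF.
apply/seteqP; split=> [C [[Croute _] Cmax]|_ ->].
  by apply/esym/Cmax => // p /Croute.
by split=> // D [Droute _] sub; apply/seteqP; split.
Qed.

Lemma hull_routes :
  convex_hull (@unit_flow R n.+2 G @` [set p | route p]) = flow_polytope R G.
Proof.
have outE (fl : {ffun edge G -> R}) : outflow fl ord0 = \sum_e fl e :> R.
  by apply: eq_bigl => e; rewrite src0 eqxx.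
have inE' (fl : {ffun edge G -> R}) : inflow fl ord_max = \sum_e fl e :> R.
  by apply: eq_bigl => e; rewrite tgt_max eqxx.
have innerE0 (fl : {ffun edge G -> R}) v : inner v -> inflow fl v = outflow fl v :> R.
  move=> /andP[v0 vm]; transitivity (0 : R); last apply: esym.
    by apply: big1 => e; rewrite tgt_max eq_sym (negPf vm).
  by apply: big1 => e; rewrite src0 eq_sym (negPf v0).
apply/seteqP; split=> [x [k [t [a [t0 t1 Aa Ex]]]]|fl [fl0 fl1 _ _]].
  have a1 j : (forall e, 0 <= a j e) /\ \sum_e a j e = 1.
    have [p /route_singleton[e ->] <-] := Aa j.
    split=> [f|]; first by rewrite ffunE ler0n.
    rewrite (bigD1 e) //= ffunE inE eqxx big1 ?addr0 // => f nfe.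
    by rewrite ffunE inE (negPf nfe).
  have sx : \sum_e x e = 1.
    under eq_bigr do rewrite Ex.
    rewrite exchange_big /= -[RHS]t1; apply: eq_bigr => j _.
    by rewrite -mulr_sumr (a1 j).2 mulr1.
  split; rewrite ?outE ?inE' //; last by move=> v; apply: innerE0.
  move=> e; rewrite Ex; apply: sumr_ge0 => j _.
  by rewrite mulr_ge0 ?t0 ?(a1 j).1.
(* The flow values themselves are the barycentric coordinates. *)
exists #|edge G|, (fun j => fl (enum_val j)), (fun j => unit_flow R [:: enum_val j]).
split=> // [|j|e].
- rewrite -fl1 outE (reindex (@enum_val _ (edge G))) //=.
  exact/onW_bij/enum_val_bij.
- by exists [:: enum_val j] => //; apply: singleton_route.
- rewrite (bigD1 (enum_rank e)) //= enum_rankK ffunE inE eqxx mulr1 big1 ?addr0 //.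
  move=> j nj; rewrite ffunE inE; case: eqP => [E|_]; last by rewrite mulr0.
  by rewrite E enum_valK eqxx in nj.
Qed.

End NoInnerVertex.

(** The list [s] holds the vertices still to be reduced. Reduced vertices remain in the index type,
    and the last two hypotheses express that inner vertices outside [s] are isolated. *)
Lemma dkk_eq_ps (R : realType) (n : nat) (s : seq 'I_n.+2) (G : mgraph n.+2)
    (F : framing G) :
  increasing_edges G -> is_framing F ->
  sorted (fun u v : 'I_n.+2 => u < v)%N s -> {in s, forall v, inner v} ->
  {in s, forall v, (exists e : edge G, tgt e = v) /\ (exists e : edge G, src e = v)} ->
  (forall e : edge G, inner (src e) -> src e \in s) ->
  (forall e : edge G, inner (tgt e) -> tgt e \in s) ->
  dkk_triangulation R F = ps_simplices R s F.
Proof.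
elim: s G F => [|i s IH] G F G_incr F_framing s_sorted s_inner s_in_out G_src G_tgt.
  have src0 (e : edge G) : src e = ord0.
    apply/eqP; apply: contraT => ne; suff /G_src : inner (src e) by [].
    rewrite /inner ne; apply: contraTneq (G_incr e) => ->.
    by rewrite -leqNgt -ltnS ltn_ord.
  have tgt_max (e : edge G) : tgt e = ord_max.
    apply/eqP; apply: contraT => ne; suff /G_tgt : inner (tgt e) by [].
    rewrite /inner ne andbT; apply: contraTneq (G_incr e) => ->.
    by rewrite -leqNgt.
  rewrite /dkk_triangulation (maximal_clique_routes F src0 tgt_max) image_set1.
  by rewrite hull_routes.
have i_inner : inner i by apply: s_inner; rewrite mem_head.
have [i_in i_out] := s_in_out i (mem_head _ _).
have gt_i v : v \in s -> (i < v)%N.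
  move=> vs; have := order_path_min _ s_sorted.
  by move=> /(_ (fun _ _ _ => @ltn_trans _ _ _)) /allP /(_ v vs).
(* An inner source would be a remaining vertex smaller than [i], but [i] is the least of them. *)
have i_first (e : edge G) : tgt e = i -> src e = ord0.
  move=> Ee; apply/eqP; apply: contraT => ne.
  have lt : (src e < i)%N by rewrite -Ee.
  have /G_src : inner (src e).
    rewrite /inner ne; apply: contraTneq lt => ->.
    by rewrite -leqNgt -ltnS ltn_ord.
  rewrite inE => /predU1P[E|/gt_i]; first by rewrite E ltnn in lt.
  by rewrite ltnNge ltnW.
have G_ext (e : edge G) : inner (tgt e) -> exists f : edge G, src f = tgt e.
  by move=> /G_tgt /s_in_out[].
have IHT T : noncrossing_tree F i T ->
    dkk_triangulation R (inheritance_framing F i T) =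
    ps_simplices R s (inheritance_framing F i T).
  move=> tree; have [Ti [_ conn _] _] := tree.
  apply: IH.
  - exact: reduced_incr.
  - exact: reduced_framing.
  - exact: path_sorted s_sorted.
  - by move=> v vs; apply: s_inner; rewrite inE vs orbT.
  - move=> v vs; have lt_iv := gt_i v vs.
    have nvi : v != i by apply: contraTneq lt_iv => ->; rewrite ltnn.
    have v_in : inner v by apply: s_inner; rewrite inE vs orbT.
    have vs' : v \in i :: s by rewrite inE vs orbT.
    have [[e Ee] [f Ef]] := s_in_out v vs'.
    split; last first.
      have [||a [Fa _ _]] := @surviving_edge n G i T f; rewrite ?Ef //.
        apply/eqP => /i_first; rewrite Ef => E; by move: v_in; rewrite E.
      by exists a; rewrite -Ef -Fa.
    have [Ei|ni] := eqVneq (src e) i; last first.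
      have [||a [_ La _]] := @surviving_edge n G i T e; rewrite ?Ee //.
      by exists a; rewrite -Ee -La.
    (* The edge [e] leaves [i], so it is a right vertex of the tree; connectedness gives it a
       neighbour [e'], and the sum of [e'] and [e] enters [v]. *)
    have [e0 Ee0] := i_in.
    have /connectP[[|[e'|?] p] //= /andP[Te' _] _] :
        connect (tree_adj T) (inr e) (inl e0).
      by apply: conn; rewrite unfold_in /= ?Ei ?Ee0 eqxx.
    have [a [_ La _]] := sum_edge i Te'.
    by exists a; rewrite -Ee -La.
  - move=> a; change (inner (src (first_part a)) -> src (first_part a) \in s).
    case: (reduced_edgeP Ti a) => [e ne _ -> _ _ /G_src|e f _ Ee _ -> _ _].
      by rewrite inE (negPf ne).
    by rewrite (i_first _ Ee).
  - move=> a; change (inner (tgt (last_part a)) -> tgt (last_part a) \in s).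
    case: (reduced_edgeP Ti a) => [e _ ne _ -> _ /G_tgt|e f _ _ Ef _ -> _ /G_tgt].
      by rewrite inE (negPf ne).
    rewrite inE => /predU1P[E|//]; have := G_incr f.
    by rewrite Ef E ltnn.
apply/seteqP; split.
  move=> _ [C Cmax <-].
  have [T [tree [C' [C'max ->]]]] :=
    maximal_clique_reduced G_incr F_framing G_ext i_inner i_first i_in i_out Cmax.
  have [Ti _ _] := tree; exists T => //.
  rewrite (lift_hull_expand R G_incr Ti); last by case: C'max.1.
  exists (convex_hull (@unit_flow R n.+2 (reduced_graph i T) @` C')) => //.
  have : dkk_triangulation R (inheritance_framing F i T)
    (convex_hull (@unit_flow R n.+2 (reduced_graph i T) @` C')) by exists C'.
  by rewrite IHT.
move=> _ [T tree [D DP <-]].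
have [C' C'max <-] : dkk_triangulation R (inheritance_framing F i T) D by rewrite IHT.
have [Ti _ _] := tree; exists (@expand n G i T @` C').
  exact: maximal_clique_expand.
by rewrite (lift_hull_expand R G_incr Ti) //; case: C'max.1.
Qed.

Local Close Scope ring_scope.

Theorem theorem1p4 (R : realType) (n : nat) (G : mgraph n.+2)
    (G_increasing : increasing_edges G)
    (G_connected : connected_graph G)
    (G_inner : inner_in_out G) :
  dkk_triangulations R G `<=` framed_ps_triangulations R G.
Proof.
move=> _ [F F_framing <-]; exists F => //; apply/esym/dkk_eq_ps => //.
- rewrite /inner_vertices; apply: sorted_filter; first by move=> ? ? ?; apply: ltn_trans.
  by have := iota_ltn_sorted 0 n.+2; rewrite -val_enum_ord sorted_map.
- by move=> v; rewrite mem_filter => /andP[].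
- by move=> v; rewrite mem_filter => /andP[/G_inner].
- by move=> e e_in; rewrite mem_filter e_in mem_enum.
- by move=> e e_in; rewrite mem_filter e_in mem_enum.
Qed.
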